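(* Let $\mathbf{RQF}$ be the category of restriction quantal frames and their morphisms and $\mathbf{EC}$ the category of étale topological categories and continuous covering functors. Then $\Omega\colon\mathbf{EC}\to\mathbf{RQF}^{op}$ (sending $C$ to $\Omega(C)$ and a continuous covering functor $\theta$ to $\theta^{-1}$) is left adjoint to $\mathsf{C}\colon\mathbf{RQF}^{op}\to\mathbf{EC}$ (sending $Q$ to $\mathsf{C}(Q)$ and a morphism $\phi$ to $\phi^{-1}$). Explicitly, for every étale category $C$ and restriction quantal frame $Q$, the assignments $\alpha\mapsto\alpha^{-1}\circ\chi$ and $\beta\mapsto\beta^{-1}\circ\omega$ are mutually inverse bijections, natural in $C$ and $Q$, between continuous covering functors $\alpha\colon C\to\mathsf{C}(Q)$ and morphisms of restriction quantal frames $\beta\colon Q\to\Omega(C)$.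
   Context: A restriction quantal frame is a frame $(Q,\le)$ with associative multiplication distributing over arbitrary joins on both sides, which is a monoid with identity $e$ and carries join-preserving unary operations $a\mapsto a^{\ast}$, $a\mapsto a^{+}$ with values in the set $e^{\downarrow}=\{x:x\le e\}$ of projections (a commutative subsemigroup of idempotents), fixing projections, with $aa^{\ast}=a$, $a^{+}a=a$, $(ab)^{\ast}=(a^{\ast}b)^{\ast}$, $(ab)^{+}=(ab^{+})^{+}$; the top element is a join of partial isometries ($a$ with $b\le a\Rightarrow b=b^{+}a=ab^{\ast}$) and partial isometries are closed under product. A morphism of restriction quantal frames is a semigroup homomorphism preserving all joins, finite meets, $\ast$, $+$, the top element and the identity, and mapping partial isometries to partial isometries. Étale topological category: small category (identities $C_o$, domain/codomain maps $\mathbf{d},\mathbf{r}$) with topology making $\mathbf{d}$, $\mathbf{r}$ and multiplication on composable pairs continuous, $\mathbf{d}$, $\mathbf{r}$ local homeomorphisms. Covering functor: a functor that is $\mathbf{d}$-injective, $\mathbf{d}$-surjective, $\mathbf{r}$-injective and $\mathbf{r}$-surjective (for $\mathbf{d}$: $F(x)=F(y)$ and $\mathbf{d}(x)=\mathbf{d}(y)$ imply $x=y$; and if $F(e)=\mathbf{d}(y)$ for an identity $e$ there is $x$ with $\mathbf{d}(x)=e$, $F(x)=y$). $\Omega(C)$: open subsets of $C$ with $UV=\{uv:u\in U,v\in V,\mathbf{d}(u)=\mathbf{r}(v)\}$, identity $C_o$, $U^{\ast}=\mathbf{d}(U)$, $U^{+}=\mathbf{r}(U)$. $\mathsf{C}(Q)$: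 completely prime filters of $Q$ (nonempty, upward closed, closed under binary meets, $0\notin A$, $\bigvee_ia_i\in A\Rightarrow$ some $a_i\in A$) with $\mathbf{d}(A)=(\{a^{\ast}:a\in A\})^{\uparrow}$, $\mathbf{r}(A)=(\{a^{+}:a\in A\})^{\uparrow}$, $A\cdot B=(AB)^{\uparrow}$ when $\mathbf{d}(A)=\mathbf{r}(B)$, topology with base $\mathscr{X}_a=\{A:a\in A\}$, $a$ a partial isometry. $\chi\colon Q\to\Omega(\mathsf{C}(Q))$ is $a\mapsto\mathscr{X}_a$; $\omega\colon C\to\mathsf{C}(\Omega(C))$ is $x\mapsto\{\text{open sets containing }x\}$. *)

(* Defs.v *)
From Stdlib Require Import ClassicalEpsilon.

Definition set_eq {T : Type} (A B : T -> Prop) : Prop := forall x, A x <-> B x.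
Definition preimage {A B : Type} (f : A -> B) (P : B -> Prop) : A -> Prop :=
  fun x => P (f x).
Definition image {A B : Type} (f : A -> B) (P : A -> Prop) : B -> Prop :=
  fun y => exists x, P x /\ f x = y.

Record rqf_ops := RQFOps {
  rq :> Type;
  rle : rq -> rq -> Prop;
  rsup : (rq -> Prop) -> rq;
  rmeet : rq -> rq -> rq;
  rmul : rq -> rq -> rq;
  re : rq;
  rstar : rq -> rq;
  rplus : rq -> rq }.
Arguments rle {r} _ _.
Arguments rsup {r} _.
Arguments rmeet {r} _ _.
Arguments rmul {r} _ _.
Arguments re {r}.
Arguments rstar {r} _.
Arguments rplus {r} _.

Definition rtop (Q : rqf_ops) : Q := rsup (fun _ : Q => True).
Definition rbot (Q : rqf_ops) : Q := rsup (fun _ : Q => False).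

Definition projection (Q : rqf_ops) (x : Q) : Prop := rle x re.

Definition partial_isometry (Q : rqf_ops) (a : Q) : Prop :=
  forall b : Q, rle b a -> b = rmul (rplus b) a /\ b = rmul a (rstar b).

Record rqf_axioms (Q : rqf_ops) : Prop := {
  le_refl : forall a : Q, rle a a;
  le_antisym : forall a b : Q, rle a b -> rle b a -> a = b;
  le_trans : forall a b c : Q, rle a b -> rle b c -> rle a c;
  sup_ub : forall (S : Q -> Prop) a, S a -> rle a (rsup S);
  sup_least : forall (S : Q -> Prop) b, (forall a, S a -> rle a b) -> rle (rsup S) b;
  meet_lb1 : forall a b : Q, rle (rmeet a b) a;
  meet_lb2 : forall a b : Q, rle (rmeet a b) b;
  meet_glb : forall a b c : Q, rle c a -> rle c b -> rle c (rmeet a b);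
  meet_sup_distr : forall (a : Q) S, rmeet a (rsup S) = rsup (image (rmeet a) S);
  mul_assoc : forall a b c : Q, rmul (rmul a b) c = rmul a (rmul b c);
  mul_e_l : forall a : Q, rmul re a = a;
  mul_e_r : forall a : Q, rmul a re = a;
  mul_sup_l : forall (a : Q) S, rmul a (rsup S) = rsup (image (rmul a) S);
  mul_sup_r : forall (a : Q) S, rmul (rsup S) a = rsup (image (fun s => rmul s a) S);
  star_sup : forall S : Q -> Prop, rstar (rsup S) = rsup (image rstar S);
  plus_sup : forall S : Q -> Prop, rplus (rsup S) = rsup (image rplus S);
  star_proj : forall a : Q, projection Q (rstar a);
  plus_proj : forall a : Q, projection Q (rplus a);
  star_fix : forall x : Q, projection Q x -> rstar x = x;
  plus_fix : forall x : Q, projection Q x -> rplus x = x;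
  proj_mul_closed : forall x y : Q, projection Q x -> projection Q y -> projection Q (rmul x y);
  proj_comm : forall x y : Q, projection Q x -> projection Q y -> rmul x y = rmul y x;
  proj_idem : forall x : Q, projection Q x -> rmul x x = x;
  mul_star : forall a : Q, rmul a (rstar a) = a;
  plus_mul : forall a : Q, rmul (rplus a) a = a;
  star_mul : forall a b : Q, rstar (rmul a b) = rstar (rmul (rstar a) b);
  plus_mul_r : forall a b : Q, rplus (rmul a b) = rplus (rmul a (rplus b));
  top_pi_join : exists S : Q -> Prop,
      (forall a, S a -> partial_isometry Q a) /\ rsup S = rtop Q;
  pi_mul : forall a b : Q, partial_isometry Q a -> partial_isometry Q b ->
      partial_isometry Q (rmul a b) }.

Record rqf_morphism {Q1 Q2 : rqf_ops} (f : Q1 -> Q2) : Prop := {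
  m_mul : forall a b, f (rmul a b) = rmul (f a) (f b);
  m_sup : forall S, f (rsup S) = rsup (image f S);
  m_meet : forall a b, f (rmeet a b) = rmeet (f a) (f b);
  m_star : forall a, f (rstar a) = rstar (f a);
  m_plus : forall a, f (rplus a) = rplus (f a);
  m_top : f (rtop Q1) = rtop Q2;
  m_e : f re = re;
  m_pi : forall a, partial_isometry Q1 a -> partial_isometry Q2 (f a) }.

(* A topological space (opens closed under unions, binary intersections,
   containing the whole space) carrying a category structure: arrows are the
   points, dom = d, cod = r, comp x y = xy (meaningful when d x = r y). *)
Record topcat := TopCat {
  tc :> Type;
  isopen : (tc -> Prop) -> Prop;
  open_union : forall F : (tc -> Prop) -> Prop,
      (forall U, F U -> isopen U) -> isopen (fun x => exists U, F U /\ U x);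
  open_inter : forall U V, isopen U -> isopen V -> isopen (fun x => U x /\ V x);
  open_full : isopen (fun _ => True);
  dom : tc -> tc;
  cod : tc -> tc;
  comp : tc -> tc -> tc }.
Arguments isopen {t} _.
Arguments dom {t} _.
Arguments cod {t} _.
Arguments comp {t} _ _.

Definition ids (C : topcat) (x : C) : Prop := dom x = x.

Record etale (C : topcat) : Prop := {
  cat_cod_dom : forall x : C, cod (dom x) = dom x;
  cat_dom_cod : forall x : C, dom (cod x) = cod x;
  cat_dom_dom : forall x : C, dom (dom x) = dom x;
  cat_cod_cod : forall x : C, cod (cod x) = cod x;
  cat_comp_dom : forall x y : C, dom x = cod y -> dom (comp x y) = dom y;
  cat_comp_cod : forall x y : C, dom x = cod y -> cod (comp x y) = cod x;
  cat_assoc : forall x y z : C, dom x = cod y -> dom y = cod z ->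
      comp (comp x y) z = comp x (comp y z);
  cat_id_r : forall x : C, comp x (dom x) = x;
  cat_id_l : forall x : C, comp (cod x) x = x;
  dom_cont : forall U : C -> Prop, isopen U -> isopen (preimage dom U);
  cod_cont : forall U : C -> Prop, isopen U -> isopen (preimage cod U);
  (* multiplication continuous on composable pairs (subspace of product) *)
  comp_cont : forall (W : C -> Prop) (x y : C), isopen W -> dom x = cod y ->
      W (comp x y) ->
      exists U V, isopen U /\ isopen V /\ U x /\ V y /\
        (forall u v, U u -> V v -> dom u = cod v -> W (comp u v));
  (* d, r : C -> C_o local homeomorphisms (C_o with the subspace topology) *)
  dom_lh : forall x : C, exists U, isopen U /\ U x /\
      (forall y z, U y -> U z -> dom y = dom z -> y = z) /\
      (forall V, isopen V -> (forall y, V y -> U y) ->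
         exists W, isopen W /\ set_eq (image dom V) (fun z => W z /\ ids C z));
  cod_lh : forall x : C, exists U, isopen U /\ U x /\
      (forall y z, U y -> U z -> cod y = cod z -> y = z) /\
      (forall V, isopen V -> (forall y, V y -> U y) ->
         exists W, isopen W /\ set_eq (image cod V) (fun z => W z /\ ids C z)) }.

Record covering {C D : topcat} (F : C -> D) : Prop := {
  f_dom : forall x, F (dom x) = dom (F x);
  f_cod : forall x, F (cod x) = cod (F x);
  f_comp : forall x y, dom x = cod y -> F (comp x y) = comp (F x) (F y);
  f_cont : forall V : D -> Prop, isopen V -> isopen (preimage F V);
  f_dinj : forall x y, F x = F y -> dom x = dom y -> x = y;
  f_rinj : forall x y, F x = F y -> cod x = cod y -> x = y;
  f_dsurj : forall (e : C) (y : D), ids C e -> F e = dom y ->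
      exists x, dom x = e /\ F x = y;
  f_rsurj : forall (e : C) (y : D), ids C e -> F e = cod y ->
      exists x, cod x = e /\ F x = y }.

Definition Opens (C : topcat) : Type := {U : C -> Prop | isopen U}.

(* packs a subset as an open set; the fallback branch is never used when the
   set is open (which is the case for all uses below when C is etale) *)
Definition pack_open (C : topcat) (P : C -> Prop) : Opens C :=
  match excluded_middle_informative (isopen P) with
  | left h => exist _ P h
  | right _ => exist _ (fun _ => True) (open_full C)
  end.

Definition Omega (C : topcat) : rqf_ops := {|
  rq := Opens C;
  rle := fun U V => forall x, proj1_sig U x -> proj1_sig V x;
  rsup := fun S => pack_open C (fun x => exists U, S U /\ proj1_sig U x);
  rmeet := fun U V => pack_open C (fun x => proj1_sig U x /\ proj1_sig V x);
  rmul := fun U V => pack_open C (fun z => exists u v,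
             proj1_sig U u /\ proj1_sig V v /\ dom u = cod v /\ z = comp u v);
  re := pack_open C (ids C);
  rstar := fun U => pack_open C (image dom (proj1_sig U));
  rplus := fun U => pack_open C (image cod (proj1_sig U)) |}.

Definition cpfilter (Q : rqf_ops) (A : Q -> Prop) : Prop :=
  (exists a, A a) /\
  (forall a b, A a -> rle a b -> A b) /\
  (forall a b, A a -> A b -> A (rmeet a b)) /\
  ~ A (rbot Q) /\
  (forall S : Q -> Prop, A (rsup S) -> exists s, S s /\ A s).

Definition Filt (Q : rqf_ops) : Type := {A : Q -> Prop | cpfilter Q A}.

(* fallback branch is never used when Q is a restriction quantal frame *)
Definition pack_filter (Q : rqf_ops) (P : Q -> Prop) (dflt : Filt Q) : Filt Q :=
  match excluded_middle_informative (cpfilter Q P) with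
  | left h => exist _ P h
  | right _ => dflt
  end.

Definition filt_dom (Q : rqf_ops) (A : Filt Q) : Filt Q :=
  pack_filter Q (fun b => exists a, proj1_sig A a /\ rle (rstar a) b) A.
Definition filt_cod (Q : rqf_ops) (A : Filt Q) : Filt Q :=
  pack_filter Q (fun b => exists a, proj1_sig A a /\ rle (rplus a) b) A.
Definition filt_comp (Q : rqf_ops) (A B : Filt Q) : Filt Q :=
  pack_filter Q (fun c => exists a b, proj1_sig A a /\ proj1_sig B b /\
                                      rle (rmul a b) c) A.

Definition basic_open (Q : rqf_ops) (U : Filt Q -> Prop) : Prop :=
  exists a, partial_isometry Q a /\ set_eq U (fun A => proj1_sig A a).

Definition gen_open (Q : rqf_ops) (U : Filt Q -> Prop) : Prop :=
  forall T : (Filt Q -> Prop) -> Prop,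
    (forall F : (Filt Q -> Prop) -> Prop,
        (forall V, F V -> T V) -> T (fun x => exists V, F V /\ V x)) ->
    (forall V W, T V -> T W -> T (fun x => V x /\ W x)) ->
    T (fun _ => True) ->
    (forall V, basic_open Q V -> T V) ->
    T U.

Lemma gen_open_union (Q : rqf_ops) : forall F : (Filt Q -> Prop) -> Prop,
  (forall U, F U -> gen_open Q U) -> gen_open Q (fun x => exists U, F U /\ U x).
Proof.
  intros F HF T Hu Hi Hf Hb. apply Hu. intros V HV. apply (HF V HV); assumption.
Qed.

Lemma gen_open_inter (Q : rqf_ops) : forall U V,
  gen_open Q U -> gen_open Q V -> gen_open Q (fun x => U x /\ V x).
Proof.
  intros U V HU HV T Hu Hi Hf Hb. apply Hi; [apply HU | apply HV]; assumption.
Qed.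

Lemma gen_open_full (Q : rqf_ops) : gen_open Q (fun _ => True).
Proof. intros T Hu Hi Hf Hb. exact Hf. Qed.

Definition CQ (Q : rqf_ops) : topcat := {|
  tc := Filt Q;
  isopen := gen_open Q;
  open_union := gen_open_union Q;
  open_inter := gen_open_inter Q;
  open_full := gen_open_full Q;
  dom := filt_dom Q;
  cod := filt_cod Q;
  comp := filt_comp Q |}.

Definition chi (Q : rqf_ops) (a : Q) : Filt Q -> Prop := fun A => proj1_sig A a.
Definition omega (C : topcat) (x : C) : Opens C -> Prop := fun U => proj1_sig U x.

(* Main.v *)
(* The bijection is built from the unit and counit of the adjunction, as in
   the paper: chi : Q -> Omega(C(Q)), a |-> X_a, is a morphism of restriction
   quantal frames, and omega : C -> C(Omega(C)), x |-> {open U | x in U}, is a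
   continuous covering functor.  Hence alpha |-> Omega(alpha) o chi and
   beta |-> C(beta) o omega are well defined; both transposes express
   "a belongs to alpha(x) iff x belongs to beta(a)", which yields mutual
   inverseness and naturality by pointwise rewriting. *)

Require Import Defs.
From Stdlib Require Import ClassicalEpsilon ProofIrrelevance.
From Stdlib Require Import FunctionalExtensionality PropExtensionality.

Lemma pred_ext {T : Type} (P R : T -> Prop) : (forall x, P x <-> R x) -> P = R.
Proof.
  intro H. apply functional_extensionality; intro x.
  apply propositional_extensionality; apply H.
Qed.

Lemma sig_ext {T : Type} {P : T -> Prop} (x y : sig P) : proj1_sig x = proj1_sig y -> x = y.
Proof.
  destruct x as [x hx], y as [y hy]; simpl; intros ->. f_equal. apply proof_irrelevance.
Qed.

Lemma image_empty {T U : Type} (f : T -> U) : image f (fun _ => False) = (fun _ => False).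
Proof. apply pred_ext. intros x; split; [intros [? [[] _]] | intros []]. Qed.

Lemma join_preserving_mono {Q1 Q2 : rqf_ops} (HQ1 : rqf_axioms Q1) (HQ2 : rqf_axioms Q2)
    (f : Q1 -> Q2) : (forall S, f (rsup S) = rsup (image f S)) ->
  forall b c, rle b c -> rle (f b) (f c).
Proof.
  intros Hf b c Hbc.
  assert (Hpair : rsup (fun x => x = b \/ x = c) = c).
  { apply (le_antisym _ HQ1).
    - apply (sup_least _ HQ1). intros x [-> | ->]; [exact Hbc | apply (le_refl _ HQ1)].
    - apply (sup_ub _ HQ1). now right. }
  rewrite <- Hpair, Hf. apply (sup_ub _ HQ2). exists b. auto.
Qed.

Lemma join_preserving_bot {Q1 Q2 : rqf_ops} (f : Q1 -> Q2) :
  (forall S, f (rsup S) = rsup (image f S)) -> f (rbot Q1) = rbot Q2.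
Proof. intro Hf. unfold rbot. rewrite Hf, image_empty. reflexivity. Qed.

Section RQFAlgebra.
Context {Q : rqf_ops} (HQ : rqf_axioms Q).
Local Infix "<=q" := (@rle Q) (at level 70).
Local Infix "*q" := (@rmul Q) (at level 40, left associativity).

Lemma le_top (a : Q) : a <=q rtop Q.
Proof. apply (sup_ub _ HQ). exact I. Qed.

Lemma bot_le (a : Q) : rbot Q <=q a.
Proof. apply (sup_least _ HQ). intros _ []. Qed.

Lemma le_bot_eq (a : Q) : a <=q rbot Q -> a = rbot Q.
Proof. intro H. apply (le_antisym _ HQ); [exact H | apply bot_le]. Qed.

Lemma mul_mono_l (a b c : Q) : b <=q c -> a *q b <=q a *q c.
Proof. exact (join_preserving_mono HQ HQ (rmul a) (mul_sup_l _ HQ a) b c). Qed.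

Lemma mul_mono_r (a b c : Q) : b <=q c -> b *q a <=q c *q a.
Proof. exact (join_preserving_mono HQ HQ (fun s => s *q a) (mul_sup_r _ HQ a) b c). Qed.

Lemma mul_mono (a b c d : Q) : a <=q b -> c <=q d -> a *q c <=q b *q d.
Proof.
  intros Hab Hcd. apply (le_trans _ HQ) with (a *q d);
    [apply mul_mono_l | apply mul_mono_r]; assumption.
Qed.

Lemma star_mono (b c : Q) : b <=q c -> rstar b <=q rstar c.
Proof. exact (join_preserving_mono HQ HQ rstar (star_sup _ HQ) b c). Qed.

Lemma plus_mono (b c : Q) : b <=q c -> rplus b <=q rplus c.
Proof. exact (join_preserving_mono HQ HQ rplus (plus_sup _ HQ) b c). Qed.

Lemma mul_bot_l (a : Q) : rbot Q *q a = rbot Q.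
Proof. exact (join_preserving_bot (fun s => s *q a) (mul_sup_r _ HQ a)). Qed.

Lemma mul_bot_r (a : Q) : a *q rbot Q = rbot Q.
Proof. exact (join_preserving_bot (rmul a) (mul_sup_l _ HQ a)). Qed.

Lemma star_bot : rstar (rbot Q) = rbot Q.
Proof. exact (join_preserving_bot rstar (star_sup _ HQ)). Qed.

Lemma plus_bot : rplus (rbot Q) = rbot Q.
Proof. exact (join_preserving_bot rplus (plus_sup _ HQ)). Qed.

(* a = a a* = a+ a, so a vanishes as soon as its domain or range does. *)
Lemma star_eq_bot (a : Q) : rstar a = rbot Q -> a = rbot Q.
Proof. intro H. rewrite <- (mul_star _ HQ a), H. apply mul_bot_r. Qed.

Lemma plus_eq_bot (a : Q) : rplus a = rbot Q -> a = rbot Q.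
Proof. intro H. rewrite <- (plus_mul _ HQ a), H. apply mul_bot_l. Qed.

Lemma proj_mul_le_l (p x : Q) : projection Q p -> p *q x <=q x.
Proof. intro Hp. rewrite <- (mul_e_l _ HQ x) at 2. apply mul_mono_r. exact Hp. Qed.

Lemma proj_mul_le_r (p x : Q) : projection Q p -> x *q p <=q x.
Proof. intro Hp. rewrite <- (mul_e_r _ HQ x) at 2. apply mul_mono_l. exact Hp. Qed.

Lemma proj_below (p q : Q) : projection Q p -> q <=q p -> projection Q q.
Proof. intros Hp Hq. unfold projection. apply (le_trans _ HQ) with p; assumption. Qed.

Lemma proj_mul_absorb (p q : Q) : projection Q p -> projection Q q -> q <=q p -> p *q q = q.
Proof.
  intros Hp Hq H. apply (le_antisym _ HQ).
  - rewrite (proj_comm _ HQ) by assumption. apply proj_mul_le_r; exact Hp.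
  - rewrite <- (proj_idem _ HQ q) at 1 by exact Hq. apply mul_mono_r; exact H.
Qed.

Lemma star_mul_proj (b r : Q) : projection Q r -> r <=q rstar b -> rstar (b *q r) = r.
Proof.
  intros Hr H. rewrite (star_mul _ HQ), (star_fix _ HQ).
  - apply proj_mul_absorb; [apply (star_proj _ HQ) | exact Hr | exact H].
  - apply (proj_mul_closed _ HQ); [apply (star_proj _ HQ) | exact Hr].
Qed.

Lemma pi_star_eq (a c : Q) : partial_isometry Q a -> c <=q a -> c = a *q rstar c.
Proof. intros Ha Hc. apply (Ha c Hc). Qed.

Lemma pi_plus_eq (a c : Q) : partial_isometry Q a -> c <=q a -> c = rplus c *q a.
Proof. intros Ha Hc. apply (Ha c Hc). Qed.

Lemma pi_below (a b : Q) : partial_isometry Q a -> b <=q a -> partial_isometry Q b.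
Proof.
  intros Ha Hb c Hc. assert (Hca : c <=q a) by (apply (le_trans _ HQ) with b; assumption).
  split; apply (le_antisym _ HQ).
  - rewrite <- (plus_mul _ HQ c) at 1. apply mul_mono_l; exact Hc.
  - rewrite (pi_plus_eq a c Ha Hca) at 2. apply mul_mono_l; exact Hb.
  - rewrite <- (mul_star _ HQ c) at 1. apply mul_mono_r; exact Hc.
  - rewrite (pi_star_eq a c Ha Hca) at 2. apply mul_mono_r; exact Hb.
Qed.

Lemma sup_pi_below (a : Q) : a = rsup (fun b => partial_isometry Q b /\ b <=q a).
Proof.
  apply (le_antisym _ HQ).
  - destruct (top_pi_join _ HQ) as [S [HS Htop]].
    apply (le_trans _ HQ) with (rmeet a (rsup S)).
    + apply (meet_glb _ HQ); [apply (le_refl _ HQ) | rewrite Htop; apply le_top].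
    + rewrite (meet_sup_distr _ HQ). apply (sup_least _ HQ). intros x [s [Hs <-]].
      apply (sup_ub _ HQ). split.
      * apply pi_below with s; [exact (HS s Hs) | apply (meet_lb2 _ HQ)].
      * apply (meet_lb1 _ HQ).
  - apply (sup_least _ HQ). intros x [_ H]; exact H.
Qed.

Lemma le_sup_split (c : Q) S : c <=q rsup S -> c = rsup (image (rmeet c) S).
Proof.
  intro H. rewrite <- (meet_sup_distr _ HQ). apply (le_antisym _ HQ).
  - apply (meet_glb _ HQ); [apply (le_refl _ HQ) | exact H].
  - apply (meet_lb1 _ HQ).
Qed.

(* If the range of c lies in the domain of a, then a c = 0 forces c = 0:
   (a c+)+ = (a c)+ = 0 while (a c+)* = c+. *)
Lemma mul_eq_bot_cancel (a c : Q) : rplus c <=q rstar a -> a *q c = rbot Q -> c = rbot Q.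
Proof.
  intros L Z.
  assert (Z2 : a *q rplus c = rbot Q).
  { apply plus_eq_bot. rewrite <- (plus_mul_r _ HQ), Z. apply plus_bot. }
  assert (Z3 : rstar (a *q rplus c) = rplus c)
    by (apply star_mul_proj; [apply (plus_proj _ HQ) | exact L]).
  rewrite Z2, star_bot in Z3. apply plus_eq_bot. symmetry. exact Z3.
Qed.

(* For a partial isometry b, the restriction b (a b)* of b to the domain of
   a b equals a* b, so its range lies in the domain of a. *)
Lemma pi_restrict_range (a b : Q) :
  partial_isometry Q b -> rplus (b *q rstar (a *q b)) <=q rstar a.
Proof.
  intro Pb. rewrite (star_mul _ HQ), <- (pi_star_eq b (rmul (rstar a) b)); [| exact Pb |].
  - rewrite (plus_mul_r _ HQ), (plus_fix _ HQ).
    + apply proj_mul_le_r, (plus_proj _ HQ).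
    + apply (proj_mul_closed _ HQ); [apply (star_proj _ HQ) | apply (plus_proj _ HQ)].
  - apply proj_mul_le_l, (star_proj _ HQ).
Qed.

End RQFAlgebra.

Definition up_star (Q : rqf_ops) (A : Q -> Prop) : Q -> Prop :=
  fun b => exists a, A a /\ rle (rstar a) b.
Definition up_plus (Q : rqf_ops) (A : Q -> Prop) : Q -> Prop :=
  fun b => exists a, A a /\ rle (rplus a) b.
Definition up_prod (Q : rqf_ops) (A B : Q -> Prop) : Q -> Prop :=
  fun c => exists a b, A a /\ B b /\ rle (rmul a b) c.

(* The set generated upwards by b F; for F an identity filter containing b*
   this is the arrow of C(Q) through b with domain F. *)
Definition lift (Q : rqf_ops) (b : Q) (F : Q -> Prop) : Q -> Prop :=
  fun c => exists p, F p /\ rle (rmul b p) c.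

Section CompletelyPrimeFilters.
Context {Q : rqf_ops} (HQ : rqf_axioms Q).
Local Infix "<=q" := (@rle Q) (at level 70).
Local Infix "*q" := (@rmul Q) (at level 40, left associativity).
Local Notation PI := (partial_isometry Q).

Section OneFilter.
Variable A : Q -> Prop.
Hypothesis HA : cpfilter Q A.

Lemma filter_up a b : A a -> a <=q b -> A b. Proof. apply HA. Qed.
Lemma filter_meet a b : A a -> A b -> A (rmeet a b). Proof. apply HA. Qed.
Lemma filter_nbot : ~ A (rbot Q). Proof. apply HA. Qed.
Lemma filter_prime S : A (rsup S) -> exists s, S s /\ A s. Proof. apply HA. Qed.

Lemma filter_top : A (rtop Q).
Proof. destruct HA as [[a Ha] _]. apply filter_up with a; [exact Ha | apply (le_top HQ)]. Qed.

(* Since the top is a join of partial isometries, a completely prime filter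
   contains one, and then one below each of its elements. *)
Lemma filter_pi : exists s, PI s /\ A s.
Proof.
  destruct (top_pi_join _ HQ) as [S [HS Htop]].
  pose proof filter_top as T. rewrite <- Htop in T.
  destruct (filter_prime _ T) as [s [Hs As]]. eauto.
Qed.

Lemma filter_pi_below a : A a -> exists b, PI b /\ b <=q a /\ A b.
Proof.
  intro Ha. destruct filter_pi as [s [Ps As]]. exists (rmeet a s). split; [|split].
  - apply (pi_below HQ) with s; [exact Ps | apply (meet_lb2 _ HQ)].
  - apply (meet_lb1 _ HQ).
  - apply filter_meet; assumption.
Qed.

Lemma filter_star_pi a : A (rstar a) -> exists b, PI b /\ b <=q a /\ A (rstar b).
Proof.
  intro H. rewrite (sup_pi_below HQ a), (star_sup _ HQ) in H.
  destruct (filter_prime _ H) as [s [[b [[Pb Hb] <-]] As]]. eauto.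
Qed.

Lemma filter_mul_dom a p : A a -> up_star Q A p -> A (a *q p).
Proof.
  intros Ha [b [Hb H]]. apply filter_up with (rmeet a b); [apply filter_meet; assumption|].
  rewrite <- (mul_star _ HQ (rmeet a b)) at 1. apply (mul_mono HQ); [apply (meet_lb1 _ HQ)|].
  apply (le_trans _ HQ) with (rstar b); [apply (star_mono HQ), (meet_lb2 _ HQ) | exact H].
Qed.

Lemma up_star_cpfilter : cpfilter Q (up_star Q A).
Proof.
  split; [|split; [|split; [|split]]].
  - destruct HA as [[a Ha] _]. exists (rstar a), a. split; [exact Ha | apply (le_refl _ HQ)].
  - intros x y [a [Ha H1]] H2. exists a. split; [exact Ha|].
    apply (le_trans _ HQ) with x; assumption.
  - intros x y [a [Ha H1]] [b [Hb H2]]. exists (rmeet a b). split; [apply filter_meet; assumption|].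
    apply (meet_glb _ HQ).
    + apply (le_trans _ HQ) with (rstar a); [apply (star_mono HQ), (meet_lb1 _ HQ) | exact H1].
    + apply (le_trans _ HQ) with (rstar b); [apply (star_mono HQ), (meet_lb2 _ HQ) | exact H2].
  - intros [a [Ha H]]. apply (le_bot_eq HQ), (star_eq_bot HQ) in H. subst a.
    exact (filter_nbot Ha).
  - intros S [a [Ha H]].
    (* a = a (a* /\ sup S) = sup_s a (a* /\ s), so some a (a* /\ s) lies in A *)
    assert (Ea : a = rsup (image (rmul a) (image (rmeet (rstar a)) S))).
    { rewrite <- (mul_sup_l _ HQ), <- (le_sup_split HQ _ _ H). symmetry; apply (mul_star _ HQ). }
    rewrite Ea in Ha. destruct (filter_prime _ Ha) as [y [[t [[s [Hs <-]] <-]] Hy]].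
    exists s. split; [exact Hs|]. exists (a *q rmeet (rstar a) s). split; [exact Hy|].
    rewrite (star_mul_proj HQ).
    + apply (meet_lb2 _ HQ).
    + apply (proj_below HQ) with (rstar a); [apply (star_proj _ HQ) | apply (meet_lb1 _ HQ)].
    + apply (meet_lb1 _ HQ).
Qed.

Lemma up_star_e : up_star Q A re.
Proof. destruct HA as [[a Ha] _]. exists a. split; [exact Ha | apply (star_proj _ HQ)]. Qed.

Lemma up_star_of_identity : A re -> forall x, up_star Q A x <-> A x.
Proof.
  intros He x. split.
  - intros [a [Ha H]]. apply filter_up with (rmeet a re); [apply filter_meet; assumption|].
    apply (le_trans _ HQ) with (rstar a); [|exact H].
    rewrite <- (star_fix _ HQ (rmeet a re)) by apply (meet_lb2 _ HQ).
    apply (star_mono HQ), (meet_lb1 _ HQ).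
  - intros Hx. exists (rmeet x re). split; [apply filter_meet; assumption|].
    rewrite (star_fix _ HQ) by apply (meet_lb2 _ HQ). apply (meet_lb1 _ HQ).
Qed.

Lemma up_prod_up_star : forall x, up_prod Q A (up_star Q A) x <-> A x.
Proof.
  intro x. split.
  - intros [a [p [Ha [Hp H]]]]. apply filter_up with (a *q p); [|exact H].
    apply filter_mul_dom; assumption.
  - intro Hx. exists x, (rstar x). split; [exact Hx | split].
    + exists x. split; [exact Hx | apply (le_refl _ HQ)].
    + rewrite (mul_star _ HQ). apply (le_refl _ HQ).
Qed.

End OneFilter.

(* Rigidity: two filters with the same domain sharing a partial isometry a
   coincide, since every x in A satisfies x >= x /\ a = a (x /\ a)*, and
   a (x /\ a)* lies in B. *)
Lemma filter_le_by_pi A B a : cpfilter Q A -> cpfilter Q B -> PI a -> A a -> B a ->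
  (forall x, up_star Q A x -> up_star Q B x) -> forall x, A x -> B x.
Proof.
  intros HA HB Pa Aa Ba E x Ax. set (y := rmeet x a).
  assert (Ay : A y) by (apply (filter_meet A HA); assumption).
  apply (filter_up B HB) with y; [|apply (meet_lb1 _ HQ)].
  rewrite (pi_star_eq a y Pa (meet_lb2 _ HQ x a)).
  apply filter_mul_dom; [exact HB | exact Ba|].
  apply E. exists y. split; [exact Ay | apply (le_refl _ HQ)].
Qed.

Lemma filter_eq_by_pi A B a : cpfilter Q A -> cpfilter Q B -> PI a -> A a -> B a ->
  (forall x, up_star Q A x <-> up_star Q B x) -> forall x, A x <-> B x.
Proof.
  intros HA HB Pa Aa Ba E x. split.
  - apply (filter_le_by_pi A B a); try assumption. intro y. apply E.
  - apply (filter_le_by_pi B A a); try assumption. intro y. apply E.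
Qed.

Section Lifting.
Variables (b : Q) (F : Q -> Prop).
Hypotheses (HF : cpfilter Q F) (Hb : F (rstar b)).

Lemma lift_restrict p : F p -> F (rmeet p (rstar b)) /\ projection Q (rmeet p (rstar b))
  /\ rstar (b *q rmeet p (rstar b)) = rmeet p (rstar b).
Proof.
  intro Hp. assert (P : projection Q (rmeet p (rstar b))).
  { apply (proj_below HQ) with (rstar b); [apply (star_proj _ HQ) | apply (meet_lb2 _ HQ)]. }
  split; [apply (filter_meet F HF); assumption | split; [exact P|]].
  apply (star_mul_proj HQ); [exact P | apply (meet_lb2 _ HQ)].
Qed.

Lemma lift_cpfilter : PI b -> F re -> cpfilter Q (lift Q b F).
Proof.
  intros Pb He. split; [|split; [|split; [|split]]].
  - exists b, re. split; [exact He|]. rewrite (mul_e_r _ HQ). apply (le_refl _ HQ).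
  - intros x y [p [Hp H1]] H2. exists p. split; [exact Hp|].
    apply (le_trans _ HQ) with x; assumption.
  - intros x y [p [Hp H1]] [q [Hq H2]]. exists (rmeet p q).
    split; [apply (filter_meet F HF); assumption|]. apply (meet_glb _ HQ).
    + apply (le_trans _ HQ) with (b *q p); [apply (mul_mono_l HQ), (meet_lb1 _ HQ) | exact H1].
    + apply (le_trans _ HQ) with (b *q q); [apply (mul_mono_l HQ), (meet_lb2 _ HQ) | exact H2].
  - (* b (p /\ b* ) = 0 would put 0 = p /\ b* into F *)
    intros [p [Hp H]]. destruct (lift_restrict p Hp) as [K1 [_ K3]].
    assert (Z : b *q rmeet p (rstar b) = rbot Q).
    { apply (le_bot_eq HQ). apply (le_trans _ HQ) with (b *q p);
        [apply (mul_mono_l HQ), (meet_lb1 _ HQ) | exact H]. }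
    rewrite Z, (star_bot HQ) in K3. rewrite <- K3 in K1. exact (filter_nbot F HF K1).
  - (* c = b (p /\ b* ) <= sup S splits as the join of the c /\ s, whose domains
       are joined to c* in F; and c /\ s = b (c /\ s)* *)
    intros S [p [Hp H]]. destruct (lift_restrict p Hp) as [K1 [K2 K3]].
    set (c := b *q rmeet p (rstar b)).
    assert (Hcb : c <=q b) by (apply (proj_mul_le_r HQ); exact K2).
    assert (Hc : c <=q rsup S).
    { apply (le_trans _ HQ) with (b *q p); [apply (mul_mono_l HQ), (meet_lb1 _ HQ) | exact H]. }
    assert (Fc : F (rstar c)) by (unfold c; rewrite K3; exact K1).
    rewrite (le_sup_split HQ c S Hc), (star_sup _ HQ) in Fc.
    destruct (filter_prime F HF _ Fc) as [y [[t [[s [Hs <-]] <-]] Hy]].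
    exists s. split; [exact Hs|]. exists (rstar (rmeet c s)). split; [exact Hy|].
    rewrite <- (pi_star_eq b); [apply (meet_lb2 _ HQ) | exact Pb|].
    apply (le_trans _ HQ) with c; [apply (meet_lb1 _ HQ) | exact Hcb].
Qed.

Lemma lift_dom : forall x, up_star Q (lift Q b F) x <-> F x.
Proof.
  intro x. split.
  - intros [y [[p [Hp H1]] H2]]. destruct (lift_restrict p Hp) as [K1 [_ K3]].
    apply (filter_up F HF) with (rmeet p (rstar b)); [exact K1|]. rewrite <- K3.
    apply (le_trans _ HQ) with (rstar y); [|exact H2].
    apply (star_mono HQ). apply (le_trans _ HQ) with (b *q p);
      [apply (mul_mono_l HQ), (meet_lb1 _ HQ) | exact H1].
  - intro Hx. destruct (lift_restrict x Hx) as [K1 [_ K3]].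
    exists (b *q rmeet x (rstar b)). split.
    + exists (rmeet x (rstar b)). split; [exact K1 | apply (le_refl _ HQ)].
    + rewrite K3. apply (meet_lb1 _ HQ).
Qed.

Lemma lift_contains : F re -> lift Q b F b.
Proof. intro He. exists re. split; [exact He|]. rewrite (mul_e_r _ HQ). apply (le_refl _ HQ). Qed.

End Lifting.

Lemma lift_spec b F : PI b -> cpfilter Q F -> F re -> F (rstar b) ->
  cpfilter Q (lift Q b F) /\ (forall x, up_star Q (lift Q b F) x <-> F x) /\ lift Q b F b.
Proof.
  intros Pb HF He Hb. split; [|split].
  - apply lift_cpfilter; assumption.
  - apply lift_dom; assumption.
  - apply lift_contains; assumption.
Qed.

End CompletelyPrimeFilters.

Section FilterProducts.
Context {Q : rqf_ops} (HQ : rqf_axioms Q).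
Local Infix "<=q" := (@rle Q) (at level 70).
Local Infix "*q" := (@rmul Q) (at level 40, left associativity).
Local Notation PI := (partial_isometry Q).

Definition composable_sets (A B : Q -> Prop) : Prop :=
  forall x, up_star Q A x <-> up_plus Q B x.

Section TwoFilters.
Variables A B : Q -> Prop.
Hypotheses (HA : cpfilter Q A) (HB : cpfilter Q B) (HAB : composable_sets A B).

(* The product avoids 0: for a in A pick b' in B with b'+ <= a*; then
   a (b /\ b') = 0 would force b /\ b' = 0. *)
Lemma up_prod_nbot : ~ up_prod Q A B (rbot Q).
Proof.
  intros [a [b [Ha [Hb H]]]].
  assert (Hs : up_star Q A (rstar a)) by (exists a; split; [exact Ha | apply (le_refl _ HQ)]).
  apply HAB in Hs. destruct Hs as [b' [Hb' H']].
  apply (filter_nbot B HB). rewrite <- (mul_eq_bot_cancel HQ a (rmeet b b')).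
  - apply (filter_meet B HB); assumption.
  - apply (le_trans _ HQ) with (rplus b'); [apply (plus_mono HQ), (meet_lb2 _ HQ) | exact H'].
  - apply (le_bot_eq HQ). apply (le_trans _ HQ) with (a *q b);
      [apply (mul_mono_l HQ), (meet_lb1 _ HQ) | exact H].
Qed.

(* Primeness: take partial isometries a in A, b in B below the given
   factors; then a b+ lies in A and equals (a b)+ a, which splits along any
   join above a b. *)
Lemma up_prod_prime S : up_prod Q A B (rsup S) -> exists s, S s /\ up_prod Q A B s.
Proof.
  intros [a0 [b0 [Ha0 [Hb0 H]]]].
  destruct (filter_pi_below HQ A HA a0 Ha0) as [a [Pa [Ha1 Ha]]].
  destruct (filter_pi_below HQ B HB b0 Hb0) as [b [Pb [Hb1 Hb]]].
  assert (Pab : PI (a *q b)) by (apply (pi_mul _ HQ); assumption).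
  assert (Aab : A (a *q rplus b)).
  { apply (filter_mul_dom HQ A HA); [exact Ha|]. apply HAB.
    exists b. split; [exact Hb | apply (le_refl _ HQ)]. }
  assert (Eab : a *q rplus b = rplus (a *q b) *q a).
  { rewrite (plus_mul_r _ HQ). apply pi_plus_eq; [exact Pa|].
    apply (proj_mul_le_r HQ). apply (plus_proj _ HQ). }
  rewrite Eab, (le_sup_split HQ (a *q b) S), (plus_sup _ HQ), (mul_sup_r _ HQ) in Aab
    by (apply (le_trans _ HQ) with (a0 *q b0); [apply (mul_mono HQ); assumption | exact H]).
  destruct (filter_prime A HA _ Aab) as [y [[z [[t [[s [Hs <-]] <-]] <-]] Hy]].
  exists s. split; [exact Hs|]. exists (rplus (rmeet (a *q b) s) *q a), b.
  split; [exact Hy | split; [exact Hb|]].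
  rewrite (mul_assoc _ HQ), <- pi_plus_eq;
    [apply (meet_lb2 _ HQ) | exact Pab | apply (meet_lb1 _ HQ)].
Qed.

Lemma up_prod_cpfilter : cpfilter Q (up_prod Q A B).
Proof.
  split; [|split; [|split; [|split]]].
  - destruct HA as [[a Ha] _]. destruct HB as [[b Hb] _].
    exists (a *q b), a, b. split; [exact Ha | split; [exact Hb | apply (le_refl _ HQ)]].
  - intros x y [a [b [Ha [Hb H1]]]] H2. exists a, b.
    split; [exact Ha | split; [exact Hb | apply (le_trans _ HQ) with x; assumption]].
  - intros x y [a [b [Ha [Hb H1]]]] [a' [b' [Ha' [Hb' H2]]]].
    exists (rmeet a a'), (rmeet b b').
    split; [apply (filter_meet A HA); assumption|].
    split; [apply (filter_meet B HB); assumption|].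
    apply (meet_glb _ HQ).
    + apply (le_trans _ HQ) with (a *q b); [|exact H1].
      apply (mul_mono HQ); apply (meet_lb1 _ HQ).
    + apply (le_trans _ HQ) with (a' *q b'); [|exact H2].
      apply (mul_mono HQ); apply (meet_lb2 _ HQ).
  - exact up_prod_nbot.
  - exact up_prod_prime.
Qed.

Lemma up_prod_dom : forall x, up_star Q (up_prod Q A B) x <-> up_star Q B x.
Proof.
  intro x. split.
  - intros [y [[a [b [Ha [Hb H1]]]] H2]].
    assert (Hs : up_star Q A (rstar a)) by (exists a; split; [exact Ha | apply (le_refl _ HQ)]).
    apply HAB in Hs. destruct Hs as [b' [Hb' H']].
    exists (rmeet b b'). split; [apply (filter_meet B HB); assumption|].
    apply (le_trans _ HQ) with (rstar y); [|exact H2].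
    apply (le_trans _ HQ) with (rstar (a *q b)); [|apply (star_mono HQ); exact H1].
    rewrite (star_mul _ HQ). apply (star_mono HQ).
    rewrite <- (plus_mul _ HQ (rmeet b b')) at 1. apply (mul_mono HQ); [|apply (meet_lb1 _ HQ)].
    apply (le_trans _ HQ) with (rplus b'); [apply (plus_mono HQ), (meet_lb2 _ HQ) | exact H'].
  - intros [b [Hb H]]. destruct HA as [[a Ha] _]. exists (a *q b). split.
    + exists a, b. split; [exact Ha | split; [exact Hb | apply (le_refl _ HQ)]].
    + apply (le_trans _ HQ) with (rstar b); [|exact H].
      rewrite (star_mul _ HQ). apply (star_mono HQ), (proj_mul_le_l HQ), (star_proj _ HQ).
Qed.

End TwoFilters.

Lemma up_prod_assoc A B C x : up_prod Q (up_prod Q A B) C x <-> up_prod Q A (up_prod Q B C) x.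
Proof.
  split.
  - intros [y [c [[a [b [Ha [Hb H1]]]] [Hc H2]]]]. exists a, (b *q c).
    split; [exact Ha | split].
    + exists b, c. split; [exact Hb | split; [exact Hc | apply (le_refl _ HQ)]].
    + rewrite <- (mul_assoc _ HQ). apply (le_trans _ HQ) with (y *q c);
        [apply (mul_mono_r HQ); exact H1 | exact H2].
  - intros [a [y [Ha [[b [c [Hb [Hc H1]]]] H2]]]]. exists (a *q b), c.
    split; [|split; [exact Hc|]].
    + exists a, b. split; [exact Ha | split; [exact Hb | apply (le_refl _ HQ)]].
    + rewrite (mul_assoc _ HQ). apply (le_trans _ HQ) with (a *q y);
        [apply (mul_mono_l HQ); exact H1 | exact H2].
Qed.

End FilterProducts.

(* The opposite frame reverses multiplication and exchanges * and +; it is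
   again a restriction quantal frame, which yields the codomain versions of the
   results above. *)
Definition opQ (Q : rqf_ops) : rqf_ops := {|
  rq := Q; rle := @rle Q; rsup := @rsup Q; rmeet := @rmeet Q;
  rmul := fun a b => @rmul Q b a; re := @re Q; rstar := @rplus Q; rplus := @rstar Q |}.

Lemma pi_op (Q : rqf_ops) (a : Q) : partial_isometry (opQ Q) a <-> partial_isometry Q a.
Proof. split; intros H b Hb; destruct (H b Hb); split; assumption. Qed.

Lemma op_axioms {Q : rqf_ops} : rqf_axioms Q -> rqf_axioms (opQ Q).
Proof.
  intro H. destruct H. split; simpl; auto.
  - intros. apply proj_mul_closed; auto.
  - destruct top_pi_join as [S [H1 H2]]. exists S. split; auto. intros a Ha. apply pi_op. auto.
  - intros a b Ha Hb. apply pi_op. apply pi_op in Ha. apply pi_op in Hb. apply pi_mul; auto.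
Qed.

Lemma morph_op {Q Q' : rqf_ops} (ph : Q' -> Q) :
  rqf_morphism ph -> @rqf_morphism (opQ Q') (opQ Q) ph.
Proof.
  intro H. destruct H. split; simpl; auto.
  intros a Ha. apply pi_op. apply pi_op in Ha. auto.
Qed.

Definition lift_plus (Q : rqf_ops) (b : Q) (F : Q -> Prop) : Q -> Prop :=
  fun c => exists p, F p /\ rle (rmul p b) c.

Section CodomainDuals.
Context {Q : rqf_ops} (HQ : rqf_axioms Q).
Local Notation HO := (op_axioms HQ).
Local Notation PI := (partial_isometry Q).

Lemma up_plus_cpfilter A : cpfilter Q A -> cpfilter Q (up_plus Q A).
Proof. exact (up_star_cpfilter HO A). Qed.

Lemma up_plus_e A : cpfilter Q A -> up_plus Q A re.
Proof. exact (up_star_e HO A). Qed.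

Lemma up_plus_of_identity F : cpfilter Q F -> F re -> forall x, up_plus Q F x <-> F x.
Proof. exact (up_star_of_identity HO F). Qed.

Lemma filter_mul_cod A a p : cpfilter Q A -> A a -> up_plus Q A p -> A (rmul p a).
Proof. intro HA. exact (filter_mul_dom HO A HA a p). Qed.

Lemma filter_plus_pi F a : cpfilter Q F -> F (rplus a) ->
  exists b, PI b /\ rle b a /\ F (rplus b).
Proof.
  intros HF Ha. destruct (filter_star_pi HO F HF a Ha) as [b [Pb Hb]].
  exists b. split; [apply pi_op; exact Pb | exact Hb].
Qed.

Lemma filter_eq_by_pi_cod A B a : cpfilter Q A -> cpfilter Q B -> PI a -> A a -> B a ->
  (forall x, up_plus Q A x <-> up_plus Q B x) -> forall x, A x <-> B x.
Proof. intros HA HB Pa. apply (filter_eq_by_pi HO A B a HA HB). apply pi_op; exact Pa. Qed.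

Lemma lift_plus_spec b F : PI b -> cpfilter Q F -> F re -> F (rplus b) ->
  cpfilter Q (lift_plus Q b F) /\ (forall x, up_plus Q (lift_plus Q b F) x <-> F x) /\
  lift_plus Q b F b.
Proof. intro Pb. apply (lift_spec HO b F). apply pi_op; exact Pb. Qed.

Lemma up_prod_op A B x : up_prod (opQ Q) A B x <-> up_prod Q B A x.
Proof. split; intros [a [b [Ha [Hb H]]]]; exists b, a; auto. Qed.

Lemma up_prod_cod A B : cpfilter Q A -> cpfilter Q B -> composable_sets A B ->
  forall x, up_plus Q (up_prod Q A B) x <-> up_plus Q A x.
Proof.
  intros HA HB HAB x.
  rewrite <- (up_prod_dom HO B A HB HA (fun y => iff_sym (HAB y)) x).
  split; intros [y [Hy1 Hy2]]; exists y; split; auto; apply up_prod_op; auto.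
Qed.

Lemma up_prod_up_plus A : cpfilter Q A -> forall x, up_prod Q (up_plus Q A) A x <-> A x.
Proof. intros HA x. rewrite <- up_prod_op. exact (up_prod_up_star HO A HA x). Qed.

End CodomainDuals.

Lemma pack_filter_spec (Q : rqf_ops) P d : cpfilter Q P -> proj1_sig (pack_filter Q P d) = P.
Proof.
  intro H. unfold pack_filter.
  destruct (excluded_middle_informative (cpfilter Q P)); [reflexivity | contradiction].
Qed.

Lemma filt_ext (Q : rqf_ops) (A B : Filt Q) :
  (forall x, proj1_sig A x <-> proj1_sig B x) -> A = B.
Proof. intro H. apply sig_ext, pred_ext. exact H. Qed.

Section FilterCategory.
Context {Q : rqf_ops} (HQ : rqf_axioms Q).
Local Infix "<=q" := (@rle Q) (at level 70).
Local Notation PI := (partial_isometry Q).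

Lemma filt_cpfilter (A : Filt Q) : cpfilter Q (proj1_sig A).
Proof. exact (proj2_sig A). Qed.

Lemma dom_spec (A : Filt Q) : proj1_sig (filt_dom Q A) = up_star Q (proj1_sig A).
Proof. apply pack_filter_spec, (up_star_cpfilter HQ), filt_cpfilter. Qed.

Lemma cod_spec (A : Filt Q) : proj1_sig (filt_cod Q A) = up_plus Q (proj1_sig A).
Proof. apply pack_filter_spec, (up_plus_cpfilter HQ), filt_cpfilter. Qed.

Lemma composable_iff (A B : Filt Q) :
  filt_dom Q A = filt_cod Q B <-> composable_sets (proj1_sig A) (proj1_sig B).
Proof.
  split.
  - intros E x. rewrite <- dom_spec, <- cod_spec, E. reflexivity.
  - intro E. apply filt_ext. intro x. rewrite dom_spec, cod_spec. apply E.
Qed.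

Lemma comp_spec (A B : Filt Q) : composable_sets (proj1_sig A) (proj1_sig B) ->
  proj1_sig (filt_comp Q A B) = up_prod Q (proj1_sig A) (proj1_sig B).
Proof. intro H. apply pack_filter_spec, (up_prod_cpfilter HQ); auto; apply filt_cpfilter. Qed.

Lemma ids_iff (A : Filt Q) : ids (CQ Q) A <-> proj1_sig A re.
Proof.
  unfold ids; simpl. split.
  - intro E. rewrite <- E, dom_spec. apply (up_star_e HQ), filt_cpfilter.
  - intro H. apply filt_ext. intro x. rewrite dom_spec.
    apply (up_star_of_identity HQ); [apply filt_cpfilter | exact H].
Qed.

Lemma dom_contains_e (A : Filt Q) : proj1_sig (filt_dom Q A) re.
Proof. rewrite dom_spec. apply (up_star_e HQ), filt_cpfilter. Qed.

Lemma cod_contains_e (A : Filt Q) : proj1_sig (filt_cod Q A) re.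
Proof. rewrite cod_spec. apply (up_plus_e HQ), filt_cpfilter. Qed.

Lemma dom_of_identity (A : Filt Q) : proj1_sig A re -> filt_dom Q A = A.
Proof.
  intro H. apply filt_ext. intro x. rewrite dom_spec.
  apply (up_star_of_identity HQ); [apply filt_cpfilter | exact H].
Qed.

Lemma cod_of_identity (A : Filt Q) : proj1_sig A re -> filt_cod Q A = A.
Proof.
  intro H. apply filt_ext. intro x. rewrite cod_spec.
  apply (up_plus_of_identity HQ); [apply filt_cpfilter | exact H].
Qed.

Lemma open_basic_nbhd V : gen_open Q V -> forall A : Filt Q, V A ->
  exists b, PI b /\ chi Q b A /\ forall B : Filt Q, chi Q b B -> V B.
Proof.
  intro HV. apply HV.
  - intros F HF A [U [HU HA]]. destruct (HF U HU A HA) as [b [Pb [Ab Hb]]].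
    exists b. split; [exact Pb | split; [exact Ab|]]. intros B HB. exists U. auto.
  - intros V1 V2 H1 H2 A [HA1 HA2].
    destruct (H1 A HA1) as [b1 [P1 [A1 K1]]], (H2 A HA2) as [b2 [P2 [A2 K2]]].
    exists (rmeet b1 b2). split; [|split].
    + apply (pi_below HQ) with b1; [exact P1 | apply (meet_lb1 _ HQ)].
    + apply (filter_meet _ (filt_cpfilter A)); assumption.
    + intros B HB. split; [apply K1 | apply K2];
        apply (filter_up _ (filt_cpfilter B)) with (rmeet b1 b2);
        [exact HB | apply (meet_lb1 _ HQ) | exact HB | apply (meet_lb2 _ HQ)].
  - intros A _. destruct (filter_pi HQ _ (filt_cpfilter A)) as [s [Ps As]]. exists s. auto.
  - intros V0 [a [Pa E]] A HA. exists a. split; [exact Pa|]. split; [apply E; exact HA|].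
    intros B HB. apply E; exact HB.
Qed.

Lemma pi_chi_open a : PI a -> gen_open Q (chi Q a).
Proof. intros Pa T _ _ _ Hb. apply Hb. exists a. split; [exact Pa|]. intro; reflexivity. Qed.

(* For a monotone f, the filters A with f c <= a for some c in A form an
   open set: it is the union of the X_b, b a partial isometry with f b <= a. *)
Lemma up_image_open (f : Q -> Q) : (forall b c, b <=q c -> f b <=q f c) ->
  forall a, gen_open Q (fun A : Filt Q => exists c, proj1_sig A c /\ f c <=q a).
Proof.
  intros Hf a.
  set (F := fun U : Filt Q -> Prop => exists b, PI b /\ f b <=q a /\ U = chi Q b).
  replace (fun A : Filt Q => exists c, proj1_sig A c /\ f c <=q a)
    with (fun A => exists U, F U /\ U A).
  - apply gen_open_union. intros U [b [Pb [_ ->]]]. apply pi_chi_open; exact Pb.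
  - apply pred_ext. intro A. split.
    + intros [U [[b [Pb [Hb ->]]] Ab]]. exists b. auto.
    + intros [c [Ac H]].
      destruct (filter_pi_below HQ _ (filt_cpfilter A) c Ac) as [b [Pb [Hbc Ab]]].
      exists (chi Q b). split; [|exact Ab]. exists b. split; [exact Pb | split; [|reflexivity]].
      apply (le_trans _ HQ) with (f c); [apply Hf; exact Hbc | exact H].
Qed.

(* X_a is open for every a: it is the union of the X_b, b <= a. *)
Lemma chi_open a : gen_open Q (chi Q a).
Proof.
  replace (chi Q a) with (fun A : Filt Q => exists c, proj1_sig A c /\ c <=q a).
  - apply up_image_open. auto.
  - apply pred_ext. intro A. split.
    + intros [c [Ac H]]. apply (filter_up _ (filt_cpfilter A)) with c; assumption.
    + intro H. exists a. split; [exact H | apply (le_refl _ HQ)].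
Qed.

Lemma continuous_into_CQ (C : topcat) (f : C -> Filt Q) :
  (forall a, PI a -> isopen (fun x => chi Q a (f x))) ->
  forall V, gen_open Q V -> isopen (preimage f V).
Proof.
  intros Hb V HV. apply HV.
  - intros F HF.
    set (G := fun W : C -> Prop => exists U, F U /\ W = preimage f U).
    replace (preimage f (fun x => exists U, F U /\ U x)) with (fun x => exists W, G W /\ W x).
    + apply open_union. intros W [U [HU ->]]. apply HF; exact HU.
    + apply pred_ext. intro x. unfold preimage. split.
      * intros [W [[U [HU ->]] Hx]]. exists U. auto.
      * intros [U [HU Hx]]. exists (preimage f U). split; [exists U; auto | exact Hx].
  - intros V1 V2 H1 H2. apply (open_inter C _ _ H1 H2).
  - apply open_full.
  - intros V0 [a [Pa E]]. replace V0 with (chi Q a) by (symmetry; apply pred_ext; exact E).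
    apply Hb; exact Pa.
Qed.

End FilterCategory.

Section FilterCategoryIsEtale.
Context {Q : rqf_ops} (HQ : rqf_axioms Q).
Local Infix "<=q" := (@rle Q) (at level 70).
Local Notation PI := (partial_isometry Q).

Lemma CQ_comp_dom (x y : Filt Q) :
  filt_dom Q x = filt_cod Q y -> filt_dom Q (filt_comp Q x y) = filt_dom Q y.
Proof.
  intro H. apply (composable_iff HQ) in H. apply filt_ext. intro a.
  rewrite !(dom_spec HQ), (comp_spec HQ) by exact H.
  apply (up_prod_dom HQ); [apply filt_cpfilter | apply filt_cpfilter | exact H].
Qed.

Lemma CQ_comp_cod (x y : Filt Q) :
  filt_dom Q x = filt_cod Q y -> filt_cod Q (filt_comp Q x y) = filt_cod Q x.
Proof.
  intro H. apply (composable_iff HQ) in H. apply filt_ext. intro a.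
  rewrite !(cod_spec HQ), (comp_spec HQ) by exact H.
  apply (up_prod_cod HQ); [apply filt_cpfilter | apply filt_cpfilter | exact H].
Qed.

Lemma CQ_assoc (x y z : Filt Q) : filt_dom Q x = filt_cod Q y -> filt_dom Q y = filt_cod Q z ->
  filt_comp Q (filt_comp Q x y) z = filt_comp Q x (filt_comp Q y z).
Proof.
  intros H1 H2.
  assert (H3 : filt_dom Q (filt_comp Q x y) = filt_cod Q z) by (rewrite CQ_comp_dom; assumption).
  assert (H4 : filt_dom Q x = filt_cod Q (filt_comp Q y z)) by (rewrite CQ_comp_cod; assumption).
  apply (composable_iff HQ) in H1, H2, H3, H4.
  apply filt_ext. intro a.
  rewrite (comp_spec HQ _ _ H3), (comp_spec HQ _ _ H4), !(comp_spec HQ) by assumption.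
  apply (up_prod_assoc HQ).
Qed.

Lemma CQ_id_r (x : Filt Q) : filt_comp Q x (filt_dom Q x) = x.
Proof.
  assert (H : filt_dom Q x = filt_cod Q (filt_dom Q x))
    by (rewrite (cod_of_identity HQ); [reflexivity | apply (dom_contains_e HQ)]).
  apply (composable_iff HQ) in H. apply filt_ext. intro a.
  rewrite (comp_spec HQ _ _ H), (dom_spec HQ). apply (up_prod_up_star HQ), filt_cpfilter.
Qed.

Lemma CQ_id_l (x : Filt Q) : filt_comp Q (filt_cod Q x) x = x.
Proof.
  assert (H : filt_dom Q (filt_cod Q x) = filt_cod Q x)
    by (apply (dom_of_identity HQ), (cod_contains_e HQ)).
  apply (composable_iff HQ) in H. apply filt_ext. intro a.
  rewrite (comp_spec HQ _ _ H), (cod_spec HQ). apply (up_prod_up_plus HQ), filt_cpfilter.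
Qed.

Lemma CQ_dom_cont (U : Filt Q -> Prop) : gen_open Q U -> gen_open Q (preimage (filt_dom Q) U).
Proof.
  apply (continuous_into_CQ (CQ Q)). intros a _. simpl.
  replace (fun x => chi Q a (filt_dom Q x))
    with (fun A : Filt Q => exists c, proj1_sig A c /\ rstar c <=q a).
  - apply (up_image_open HQ), (star_mono HQ).
  - apply pred_ext. intro A. unfold chi. rewrite (dom_spec HQ). reflexivity.
Qed.

Lemma CQ_cod_cont (U : Filt Q -> Prop) : gen_open Q U -> gen_open Q (preimage (filt_cod Q) U).
Proof.
  apply (continuous_into_CQ (CQ Q)). intros a _. simpl.
  replace (fun x => chi Q a (filt_cod Q x))
    with (fun A : Filt Q => exists c, proj1_sig A c /\ rplus c <=q a).
  - apply (up_image_open HQ), (plus_mono HQ).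
  - apply pred_ext. intro A. unfold chi. rewrite (cod_spec HQ). reflexivity.
Qed.

(* Continuity of composition is proved by induction on the generated
   topology: for a basic X_c containing x y, c >= a b with a in x, b in y, and
   X_a X_b lies in X_c. *)
Lemma CQ_comp_cont (W : Filt Q -> Prop) (x y : Filt Q) :
  gen_open Q W -> filt_dom Q x = filt_cod Q y -> W (filt_comp Q x y) ->
  exists U V, gen_open Q U /\ gen_open Q V /\ U x /\ V y /\
    (forall u v, U u -> V v -> filt_dom Q u = filt_cod Q v -> W (filt_comp Q u v)).
Proof.
  intro HW. revert x y. apply HW.
  - intros F HF x y Hxy [U [HU Hx]].
    destruct (HF U HU x y Hxy Hx) as [U1 [V1 [K1 [K2 [K3 [K4 K5]]]]]].
    exists U1, V1. repeat split; auto. intros u v Hu Hv Huv. exists U. auto.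
  - intros W1 W2 H1 H2 x y Hxy [Hx1 Hx2].
    destruct (H1 x y Hxy Hx1) as [U1 [V1 [K1 [K2 [K3 [K4 K5]]]]]].
    destruct (H2 x y Hxy Hx2) as [U2 [V2 [L1 [L2 [L3 [L4 L5]]]]]].
    exists (fun z => U1 z /\ U2 z), (fun z => V1 z /\ V2 z).
    split; [apply gen_open_inter; auto|]. split; [apply gen_open_inter; auto|].
    split; [auto | split; [auto|]]. intros u v [Hu1 Hu2] [Hv1 Hv2] Huv. split; auto.
  - intros x y _ _. exists (fun _ => True), (fun _ => True).
    repeat split; auto; apply gen_open_full.
  - intros V [c [Pc E]] x y Hxy Hc. apply E in Hc. apply (composable_iff HQ) in Hxy.
    rewrite (comp_spec HQ) in Hc by exact Hxy. destruct Hc as [a [b [Ha [Hb H]]]].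
    exists (chi Q a), (chi Q b).
    split; [apply (chi_open HQ) | split; [apply (chi_open HQ)|]].
    split; [exact Ha | split; [exact Hb|]].
    intros u v Hu Hv Huv. apply (composable_iff HQ) in Huv. apply E.
    rewrite (comp_spec HQ) by exact Huv. exists a, b. auto.
Qed.

(* dom is a local homeomorphism: X_a, a a partial isometry in x, is a
   neighbourhood on which dom is injective (rigidity), and the image of an
   open V inside it is the union of the X_(b* ) over the partial isometries b
   with X_b inside V (surjectivity by lifting). *)
Lemma CQ_dom_local_homeo (x : Filt Q) : exists U, gen_open Q U /\ U x /\
  (forall y z, U y -> U z -> filt_dom Q y = filt_dom Q z -> y = z) /\
  (forall V, gen_open Q V -> (forall y, V y -> U y) ->
     exists W, gen_open Q W /\ set_eq (image (filt_dom Q) V) (fun z => W z /\ ids (CQ Q) z)).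
Proof.
  destruct (filter_pi HQ _ (filt_cpfilter x)) as [a [Pa Ha]].
  exists (chi Q a). split; [apply pi_chi_open; exact Pa | split; [exact Ha | split]].
  - intros y z Hy Hz E. apply filt_ext.
    apply (filter_eq_by_pi HQ) with a; try apply filt_cpfilter; auto.
    intro b. rewrite <- !(dom_spec HQ), E. reflexivity.
  - intros V HV _.
    set (F := fun U : Filt Q -> Prop =>
                exists b, PI b /\ (forall B : Filt Q, chi Q b B -> V B) /\ U = chi Q (rstar b)).
    exists (fun z => exists U, F U /\ U z). split.
    { apply gen_open_union. intros U [b [_ [_ ->]]]. apply (chi_open HQ). }
    intro z. split.
    + intros [A [HA <-]]. destruct (open_basic_nbhd HQ V HV A HA) as [b [Pb [Ab Hb]]].
      split; [|apply (ids_iff HQ), (dom_contains_e HQ)].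
      exists (chi Q (rstar b)). split; [exists b; auto|].
      unfold chi. rewrite (dom_spec HQ). exists b. split; [exact Ab | apply (le_refl _ HQ)].
    + intros [[U [[b [Pb [Hb ->]]] Hz]] Hid]. apply (ids_iff HQ) in Hid.
      destruct (lift_spec HQ b (proj1_sig z) Pb (filt_cpfilter z) Hid Hz) as [K1 [K2 K3]].
      exists (exist _ (lift Q b (proj1_sig z)) K1). split; [apply Hb; exact K3|].
      apply filt_ext. intro c. rewrite (dom_spec HQ). apply K2.
Qed.

Lemma CQ_cod_local_homeo (x : Filt Q) : exists U, gen_open Q U /\ U x /\
  (forall y z, U y -> U z -> filt_cod Q y = filt_cod Q z -> y = z) /\
  (forall V, gen_open Q V -> (forall y, V y -> U y) ->
     exists W, gen_open Q W /\ set_eq (image (filt_cod Q) V) (fun z => W z /\ ids (CQ Q) z)).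
Proof.
  destruct (filter_pi HQ _ (filt_cpfilter x)) as [a [Pa Ha]].
  exists (chi Q a). split; [apply pi_chi_open; exact Pa | split; [exact Ha | split]].
  - intros y z Hy Hz E. apply filt_ext.
    apply (filter_eq_by_pi_cod HQ) with a; try apply filt_cpfilter; auto.
    intro b. rewrite <- !(cod_spec HQ), E. reflexivity.
  - intros V HV _.
    set (F := fun U : Filt Q -> Prop =>
                exists b, PI b /\ (forall B : Filt Q, chi Q b B -> V B) /\ U = chi Q (rplus b)).
    exists (fun z => exists U, F U /\ U z). split.
    { apply gen_open_union. intros U [b [_ [_ ->]]]. apply (chi_open HQ). }
    intro z. split.
    + intros [A [HA <-]]. destruct (open_basic_nbhd HQ V HV A HA) as [b [Pb [Ab Hb]]].
      split; [|apply (ids_iff HQ), (cod_contains_e HQ)].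
      exists (chi Q (rplus b)). split; [exists b; auto|].
      unfold chi. rewrite (cod_spec HQ). exists b. split; [exact Ab | apply (le_refl _ HQ)].
    + intros [[U [[b [Pb [Hb ->]]] Hz]] Hid]. apply (ids_iff HQ) in Hid.
      destruct (lift_plus_spec HQ b (proj1_sig z) Pb (filt_cpfilter z) Hid Hz) as [K1 [K2 K3]].
      exists (exist _ (lift_plus Q b (proj1_sig z)) K1). split; [apply Hb; exact K3|].
      apply filt_ext. intro c. rewrite (cod_spec HQ). apply K2.
Qed.

Theorem CQ_etale : etale (CQ Q).
Proof.
  split; simpl.
  - intro x. apply (cod_of_identity HQ), (dom_contains_e HQ).
  - intro x. apply (dom_of_identity HQ), (cod_contains_e HQ).
  - intro x. apply (dom_of_identity HQ), (dom_contains_e HQ).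
  - intro x. apply (cod_of_identity HQ), (cod_contains_e HQ).
  - exact CQ_comp_dom.
  - exact CQ_comp_cod.
  - exact CQ_assoc.
  - exact CQ_id_r.
  - exact CQ_id_l.
  - exact CQ_dom_cont.
  - exact CQ_cod_cont.
  - exact CQ_comp_cont.
  - exact CQ_dom_local_homeo.
  - exact CQ_cod_local_homeo.
Qed.

End FilterCategoryIsEtale.

Lemma pack_open_spec (C : topcat) (P : C -> Prop) : isopen P -> proj1_sig (pack_open C P) = P.
Proof.
  intro H. unfold pack_open.
  destruct (excluded_middle_informative (isopen P)); [reflexivity | contradiction].
Qed.

Lemma opens_ext (C : topcat) (U V : Opens C) :
  (forall x, proj1_sig U x <-> proj1_sig V x) -> U = V.
Proof. intro H. apply sig_ext, pred_ext. exact H. Qed.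

Lemma open_local (C : topcat) (P : C -> Prop) :
  (forall x, P x -> exists U, isopen U /\ U x /\ forall y, U y -> P y) -> isopen P.
Proof.
  intro H. set (F := fun U : C -> Prop => isopen U /\ forall y, U y -> P y).
  replace P with (fun x => exists U, F U /\ U x).
  - apply open_union. intros U [HU _]. exact HU.
  - apply pred_ext. intro x. split.
    + intros [U [[_ HU] Ux]]. auto.
    + intro Px. destruct (H x Px) as [U [HU [Ux HUP]]]. exists U. split; [split|]; auto.
Qed.

Definition prodset (C : topcat) (U V : C -> Prop) : C -> Prop :=
  fun z => exists u v, U u /\ V v /\ dom u = cod v /\ z = comp u v.

Definition bisection (C : topcat) (U : C -> Prop) : Prop :=
  (forall y z, U y -> U z -> dom y = dom z -> y = z) /\
  (forall y z, U y -> U z -> cod y = cod z -> y = z).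

Section OpenSetsOfEtaleCategory.
Context {C : topcat} (HC : etale C).

Lemma id_cod (x : C) : ids C x -> cod x = x.
Proof. unfold ids. intro H. rewrite <- H at 1. rewrite (cat_cod_dom C HC). exact H. Qed.

Lemma ids_open : isopen (ids C).
Proof.
  apply open_local. intros x Hx. destruct (dom_lh C HC x) as [U [HU [Ux [Inj _]]]].
  exists (fun z => U z /\ U (dom z)). split; [|split].
  - exact (open_inter C U (preimage dom U) HU (dom_cont C HC U HU)).
  - split; [exact Ux|]. unfold ids in Hx. rewrite Hx. exact Ux.
  - intros y [H1 H2]. unfold ids. symmetry. apply Inj; auto. symmetry. apply (cat_dom_dom C HC).
Qed.

Lemma image_open_lh (f : C -> C) :
  (forall x : C, exists U, isopen U /\ U x /\ (forall y z, U y -> U z -> f y = f z -> y = z) /\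
      (forall V, isopen V -> (forall y, V y -> U y) ->
         exists W, isopen W /\ set_eq (image f V) (fun z => W z /\ ids C z))) ->
  forall V : C -> Prop, isopen V -> isopen (image f V).
Proof.
  intros Hlh V HV. apply open_local. intros y [x [Vx <-]].
  destruct (Hlh x) as [U [HU [Ux [_ K]]]].
  destruct (K (fun z => V z /\ U z)) as [W [HW E]];
    [apply (open_inter C V U HV HU) | intros z [_ H]; exact H|].
  exists (fun z => W z /\ ids C z). split; [apply (open_inter C W _ HW ids_open) | split].
  - apply E. exists x. auto.
  - intros z Hz. apply E in Hz. destruct Hz as [w [[Vw _] <-]]. exists w. auto.
Qed.

Lemma img_dom_open (V : C -> Prop) : isopen V -> isopen (image dom V).
Proof. apply image_open_lh, (dom_lh C HC). Qed.

Lemma img_cod_open (V : C -> Prop) : isopen V -> isopen (image cod V).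
Proof. apply image_open_lh, (cod_lh C HC). Qed.

(* Around u v in UV: choose a dom-injective open N at u v and open U1, V1
   with U1 V1 inside N; then the arrows of N whose domain is dom v' for some
   v' in V /\ V1 composable with some u' in U /\ U1 lie in UV. *)
Lemma prod_open (U V : C -> Prop) : isopen U -> isopen V -> isopen (prodset C U V).
Proof.
  intros HU HV. apply open_local. intros z [u [v [Uu [Vv [Huv ->]]]]].
  destruct (dom_lh C HC (comp u v)) as [N [HN [Nz [Inj _]]]].
  destruct (comp_cont C HC N u v HN Huv Nz) as [U1 [V1 [HU1 [HV1 [U1u [V1v K]]]]]].
  set (O := fun v' => V v' /\ V1 v' /\ image dom (fun u' => U u' /\ U1 u') (cod v')).
  assert (HO : isopen O).
  { apply (open_inter C V), (open_inter C V1); [exact HV | exact HV1|].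
    exact (cod_cont C HC _ (img_dom_open _ (open_inter C U U1 HU HU1))). }
  exists (fun w => N w /\ image dom O (dom w)). split; [|split].
  - apply (open_inter C N); [exact HN | exact (dom_cont C HC _ (img_dom_open _ HO))].
  - split; [exact Nz|]. exists v. split.
    + split; [exact Vv | split; [exact V1v|]]. exists u. split; [auto | exact Huv].
    + symmetry. apply (cat_comp_dom C HC). exact Huv.
  - intros w [Nw [o [[Vo [V1o [u' [[Uu' U1u'] Eu']]]] Eo]]].
    exists u', o. split; [exact Uu' | split; [exact Vo | split; [exact Eu'|]]].
    apply Inj; auto. rewrite (cat_comp_dom C HC) by exact Eu'. symmetry. exact Eo.
Qed.

End OpenSetsOfEtaleCategory.

Section OmegaIsRQF.
Context {C : topcat} (HC : etale C).

Lemma sup_spec (S : Opens C -> Prop) :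
  proj1_sig (@rsup (Omega C) S) = fun x => exists U, S U /\ proj1_sig U x.
Proof.
  simpl. apply pack_open_spec.
  set (F := fun W : C -> Prop => exists U, S U /\ W = proj1_sig U).
  replace (fun x => exists U, S U /\ proj1_sig U x) with (fun x => exists W, F W /\ W x).
  - apply open_union. intros W [U [_ ->]]. exact (proj2_sig U).
  - apply pred_ext. intro x. split.
    + intros [W [[U [HU ->]] Hx]]. exists U. auto.
    + intros [U [HU Hx]]. exists (proj1_sig U). split; [exists U; auto | exact Hx].
Qed.

Lemma meet_spec (U V : Opens C) :
  proj1_sig (@rmeet (Omega C) U V) = fun x => proj1_sig U x /\ proj1_sig V x.
Proof. simpl. apply pack_open_spec, open_inter; [exact (proj2_sig U) | exact (proj2_sig V)]. Qed.

Lemma mul_spec (U V : Opens C) :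
  proj1_sig (@rmul (Omega C) U V) = prodset C (proj1_sig U) (proj1_sig V).
Proof.
  simpl. apply pack_open_spec, (prod_open HC); [exact (proj2_sig U) | exact (proj2_sig V)].
Qed.

Lemma e_spec : proj1_sig (@re (Omega C)) = ids C.
Proof. simpl. apply pack_open_spec, (ids_open HC). Qed.

Lemma star_spec (U : Opens C) : proj1_sig (@rstar (Omega C) U) = image dom (proj1_sig U).
Proof. simpl. apply pack_open_spec, (img_dom_open HC), (proj2_sig U). Qed.

Lemma plus_spec (U : Opens C) : proj1_sig (@rplus (Omega C) U) = image cod (proj1_sig U).
Proof. simpl. apply pack_open_spec, (img_cod_open HC), (proj2_sig U). Qed.

Lemma top_spec : proj1_sig (rtop (Omega C)) = fun _ => True.
Proof.
  unfold rtop. rewrite sup_spec. apply pred_ext. intro x. split; [auto|].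
  intros _. exists (exist _ (fun _ => True) (open_full C)). simpl. auto.
Qed.

Lemma bot_spec : proj1_sig (rbot (Omega C)) = fun _ => False.
Proof.
  unfold rbot. rewrite sup_spec. apply pred_ext. intro x.
  split; [intros [U [[] _]] | intros []].
Qed.

Local Ltac omega_specs :=
  repeat rewrite ?sup_spec, ?meet_spec, ?mul_spec, ?e_spec, ?star_spec, ?plus_spec; cbv beta.
Local Ltac opens_eq := apply opens_ext; intro; omega_specs.

Lemma bisection_pi (U : Opens C) : bisection C (proj1_sig U) -> partial_isometry (Omega C) U.
Proof.
  intros [Id Ic] b Hb. simpl in Hb. split; opens_eq; split.
  - intro H. exists (cod x), x. split; [exists x; auto | split; [apply Hb; exact H | split]].
    + apply (cat_dom_cod C HC).
    + symmetry. apply (cat_id_l C HC).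
  - intros [u [v [[y [Hy <-]] [Hv [E ->]]]]]. rewrite (cat_dom_cod C HC) in E.
    assert (y = v) by (apply Ic; auto). subst y. rewrite (cat_id_l C HC). exact Hy.
  - intro H. exists x, (dom x). split; [apply Hb; exact H | split; [exists x; auto | split]].
    + symmetry. apply (cat_cod_dom C HC).
    + symmetry. apply (cat_id_r C HC).
  - intros [u [v [Hu [[y [Hy <-]] [E ->]]]]]. rewrite (cat_cod_dom C HC) in E.
    assert (u = y) by (apply Id; auto). subst u. rewrite (cat_id_r C HC). exact Hy.
Qed.

(* Conversely, restricting a partial isometry U to a dom-injective (resp.
   cod-injective) neighbourhood of x gives b with b = U b*, which forces
   every y in U with the same domain as x into that neighbourhood. *)
Lemma pi_bisection (U : Opens C) : partial_isometry (Omega C) U -> bisection C (proj1_sig U).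
Proof.
  intro P. split.
  - intros x y Hx Hy E. destruct (dom_lh C HC x) as [U0 [HU0 [U0x [Inj _]]]].
    set (b := exist _ (fun z => proj1_sig U z /\ U0 z)
                (open_inter C _ _ (proj2_sig U) HU0) : Opens C).
    assert (Hb : @rle (Omega C) b U) by (intros z [H _]; exact H).
    destruct (P b Hb) as [_ E2].
    assert (Hyb : proj1_sig b y).
    { rewrite E2, mul_spec, star_spec. exists y, (dom y). split; [exact Hy | split].
      - exists x. split; [split; auto | exact E].
      - split; [symmetry; apply (cat_cod_dom C HC) | symmetry; apply (cat_id_r C HC)]. }
    destruct Hyb as [_ Hy0]. apply Inj; auto.
  - intros x y Hx Hy E. destruct (cod_lh C HC x) as [U0 [HU0 [U0x [Inj _]]]].
    set (b := exist _ (fun z => proj1_sig U z /\ U0 z)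
                (open_inter C _ _ (proj2_sig U) HU0) : Opens C).
    assert (Hb : @rle (Omega C) b U) by (intros z [H _]; exact H).
    destruct (P b Hb) as [E2 _].
    assert (Hyb : proj1_sig b y).
    { rewrite E2, mul_spec, plus_spec. exists (cod y), y. split; [|split; [exact Hy|]].
      - exists x. split; [split; auto | exact E].
      - split; [apply (cat_dom_cod C HC) | symmetry; apply (cat_id_l C HC)]. }
    destruct Hyb as [_ Hy0]. apply Inj; auto.
Qed.

Lemma projection_iff (U : Opens C) : projection (Omega C) U <-> forall x, proj1_sig U x -> ids C x.
Proof.
  unfold projection. split; intros H x Hx; specialize (H x Hx);
    [rewrite e_spec in H | rewrite e_spec]; exact H.
Qed.

Lemma prod_ids (U V : C -> Prop) : (forall x, U x -> ids C x) -> (forall x, V x -> ids C x) ->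
  forall z, prodset C U V z <-> U z /\ V z.
Proof.
  intros HU HV z. split.
  - intros [u [v [Hu [Hv [E ->]]]]].
    pose proof (HU u Hu) as Iu. unfold ids in Iu.
    rewrite Iu, (id_cod HC v (HV v Hv)) in E. subst v.
    pose proof (cat_id_r C HC u) as K. rewrite Iu in K. rewrite K. auto.
  - intros [Hu Hv]. pose proof (HU z Hu) as Iz. exists z, z.
    split; [exact Hu | split; [exact Hv | split]].
    + rewrite (id_cod HC z Iz). exact Iz.
    + pose proof (cat_id_r C HC z) as K. unfold ids in Iz. rewrite Iz in K. symmetry; exact K.
Qed.

Lemma image_sup (op : Omega C -> Omega C) (f : C -> C) :
  (forall U, proj1_sig (op U) = image f (proj1_sig U)) ->
  forall S, op (rsup S) = rsup (image op S).
Proof.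
  intros Hop S. opens_eq. rewrite !Hop, sup_spec. split.
  - intros [y [[U [HU Hy]] <-]]. exists (op U). split; [exists U; auto|].
    rewrite Hop. exists y; auto.
  - intros [W [[U [HU <-]] Hx]]. rewrite Hop in Hx. destruct Hx as [y [Hy <-]].
    exists y. split; [exists U; auto | reflexivity].
Qed.

Lemma Omega_meet_sup_distr (a : Omega C) S :
  @rmeet (Omega C) a (rsup S) = rsup (image (rmeet a) S).
Proof.
  opens_eq. split.
  - intros [Ha [U [HU Hx]]]. exists (@rmeet (Omega C) a U). split; [exists U; auto|].
    omega_specs. auto.
  - intros [W [[U [HU <-]] Hx]]. rewrite meet_spec in Hx. destruct Hx.
    split; [auto | exists U; auto].
Qed.

Lemma Omega_mul_assoc (a b c : Omega C) :
  @rmul (Omega C) (rmul a b) c = rmul a (rmul b c).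
Proof.
  opens_eq. split.
  - intros [w [z [[u [v [Hu [Hv [E1 ->]]]]] [Hz [E2 ->]]]]].
    rewrite (cat_comp_dom C HC) in E2 by exact E1.
    exists u, (comp v z). split; [exact Hu | split; [exists v, z; auto | split]].
    + rewrite (cat_comp_cod C HC) by exact E2. exact E1.
    + apply (cat_assoc C HC); auto.
  - intros [u [w [Hu [[v [z [Hv [Hz [E2 ->]]]]] [E1 ->]]]]].
    rewrite (cat_comp_cod C HC) in E1 by exact E2.
    exists (comp u v), z. split; [exists u, v; auto | split; [exact Hz | split]].
    + rewrite (cat_comp_dom C HC) by exact E1. exact E2.
    + symmetry. apply (cat_assoc C HC); auto.
Qed.

Lemma Omega_mul_e_l (a : Omega C) : @rmul (Omega C) re a = a.
Proof.
  opens_eq. split.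
  - intros [u [v [Hu [Hv [E ->]]]]]. unfold ids in Hu. rewrite Hu in E. subst u.
    rewrite (cat_id_l C HC). exact Hv.
  - intro H. exists (cod x), x. split; [unfold ids; apply (cat_dom_cod C HC)|].
    split; [exact H | split; [apply (cat_dom_cod C HC) | symmetry; apply (cat_id_l C HC)]].
Qed.

Lemma Omega_mul_e_r (a : Omega C) : @rmul (Omega C) a re = a.
Proof.
  opens_eq. split.
  - intros [u [v [Hu [Hv [E ->]]]]]. rewrite (id_cod HC v Hv) in E. subst v.
    rewrite (cat_id_r C HC). exact Hu.
  - intro H. exists x, (dom x). split; [exact H | split; [unfold ids; apply (cat_dom_dom C HC)|]].
    split; [symmetry; apply (cat_cod_dom C HC) | symmetry; apply (cat_id_r C HC)].
Qed.

Lemma Omega_mul_sup_l (a : Omega C) S : @rmul (Omega C) a (rsup S) = rsup (image (rmul a) S).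
Proof.
  opens_eq. split.
  - intros [u [v [Hu [[U [HU Hv]] [E ->]]]]]. exists (@rmul (Omega C) a U).
    split; [exists U; auto|]. omega_specs. exists u, v. auto.
  - intros [W [[U [HU <-]] Hx]]. rewrite mul_spec in Hx. destruct Hx as [u [v [Hu [Hv [E ->]]]]].
    exists u, v. split; [exact Hu | split; [exists U; auto | auto]].
Qed.

Lemma Omega_mul_sup_r (a : Omega C) S :
  @rmul (Omega C) (rsup S) a = rsup (image (fun s => rmul s a) S).
Proof.
  opens_eq. split.
  - intros [u [v [[U [HU Hu]] [Hv [E ->]]]]]. exists (@rmul (Omega C) U a).
    split; [exists U; auto|]. omega_specs. exists u, v. auto.
  - intros [W [[U [HU <-]] Hx]]. rewrite mul_spec in Hx. destruct Hx as [u [v [Hu [Hv [E ->]]]]].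
    exists u, v. split; [exists U; auto | auto].
Qed.

Lemma Omega_mul_star (a : Omega C) : @rmul (Omega C) a (rstar a) = a.
Proof.
  opens_eq. split.
  - intros [u [v [Hu [[y [Hy <-]] [E ->]]]]]. rewrite (cat_cod_dom C HC) in E.
    rewrite <- E, (cat_id_r C HC). exact Hu.
  - intro H. exists x, (dom x). split; [exact H | split; [exists x; auto|]].
    split; [symmetry; apply (cat_cod_dom C HC) | symmetry; apply (cat_id_r C HC)].
Qed.

Lemma Omega_plus_mul (a : Omega C) : @rmul (Omega C) (rplus a) a = a.
Proof.
  opens_eq. split.
  - intros [u [v [[y [Hy <-]] [Hv [E ->]]]]]. rewrite (cat_dom_cod C HC) in E.
    rewrite E, (cat_id_l C HC). exact Hv.
  - intro H. exists (cod x), x. split; [exists x; auto | split; [exact H|]].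
    split; [apply (cat_dom_cod C HC) | symmetry; apply (cat_id_l C HC)].
Qed.

(* dom(u v) = dom(dom(u) v) and cod(u v) = cod(u cod(v)). *)
Lemma Omega_star_mul (a b : Omega C) :
  @rstar (Omega C) (rmul a b) = rstar (rmul (rstar a) b).
Proof.
  opens_eq. split.
  - intros [z [[u [v [Hu [Hv [E ->]]]]] <-]]. exists (comp (dom u) v). split.
    + exists (dom u), v. split; [exists u; auto|].
      split; [exact Hv | split; [rewrite (cat_dom_dom C HC); exact E | reflexivity]].
    + rewrite !(cat_comp_dom C HC); auto. rewrite (cat_dom_dom C HC); exact E.
  - intros [z [[w [v [[u [Hu <-]] [Hv [E ->]]]]] <-]]. rewrite (cat_dom_dom C HC) in E.
    exists (comp u v). split; [exists u, v; auto|].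
    rewrite !(cat_comp_dom C HC); auto. rewrite (cat_dom_dom C HC); exact E.
Qed.

Lemma Omega_plus_mul_r (a b : Omega C) :
  @rplus (Omega C) (rmul a b) = rplus (rmul a (rplus b)).
Proof.
  opens_eq. split.
  - intros [z [[u [v [Hu [Hv [E ->]]]]] <-]]. exists (comp u (cod v)). split.
    + exists u, (cod v). split; [exact Hu|].
      split; [exists v; auto | split; [rewrite (cat_cod_cod C HC); exact E | reflexivity]].
    + rewrite !(cat_comp_cod C HC); auto. rewrite (cat_cod_cod C HC); exact E.
  - intros [z [[u [w [Hu [[v [Hv <-]] [E ->]]]]] <-]]. rewrite (cat_cod_cod C HC) in E.
    exists (comp u v). split; [exists u, v; auto|].
    rewrite !(cat_comp_cod C HC); auto. rewrite (cat_cod_cod C HC); exact E.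
Qed.

(* Every arrow has a bisection neighbourhood, the intersection of a
   dom-injective and a cod-injective open set. *)
Lemma Omega_top_pi_join : exists S : Omega C -> Prop,
  (forall a, S a -> partial_isometry (Omega C) a) /\ rsup S = rtop (Omega C).
Proof.
  exists (fun U : Opens C => bisection C (proj1_sig U)). split; [exact bisection_pi|].
  apply opens_ext. intro x. rewrite top_spec, sup_spec. split; [auto|]. intros _.
  destruct (dom_lh C HC x) as [U1 [HU1 [U1x [Inj1 _]]]].
  destruct (cod_lh C HC x) as [U2 [HU2 [U2x [Inj2 _]]]].
  exists (exist _ (fun z => U1 z /\ U2 z) (open_inter C _ _ HU1 HU2)). simpl.
  split; [|auto]. split; intros y z [Hy1 Hy2] [Hz1 Hz2] E; auto.
Qed.

Lemma Omega_pi_mul (a b : Omega C) : partial_isometry (Omega C) a -> partial_isometry (Omega C) b ->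
  partial_isometry (Omega C) (rmul a b).
Proof.
  intros Ha Hb. apply bisection_pi. rewrite mul_spec.
  apply pi_bisection in Ha, Hb. destruct Ha as [Ia Ja], Hb as [Ib Jb]. split.
  - intros y z [u [v [Hu [Hv [E ->]]]]] [u' [v' [Hu' [Hv' [E' ->]]]]] D.
    rewrite !(cat_comp_dom C HC) in D by auto. assert (v = v') by (apply Ib; auto). subst v'.
    rewrite <- E' in E. assert (u = u') by (apply Ia; auto). subst. reflexivity.
  - intros y z [u [v [Hu [Hv [E ->]]]]] [u' [v' [Hu' [Hv' [E' ->]]]]] D.
    rewrite !(cat_comp_cod C HC) in D by auto. assert (u = u') by (apply Ja; auto). subst u'.
    rewrite E' in E. assert (v = v') by (apply Jb; auto). subst. reflexivity.
Qed.

Theorem Omega_axioms : rqf_axioms (Omega C).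
Proof.
  split.
  - intros a x H; exact H.
  - intros a b H1 H2. apply opens_ext. intro x. split; [exact (H1 x) | exact (H2 x)].
  - intros a b c H1 H2 x Hx. exact (H2 x (H1 x Hx)).
  - intros S a Ha x Hx. omega_specs. exists a. auto.
  - intros S b H x. omega_specs. intros [U [HU Hx]]. exact (H U HU x Hx).
  - intros a b x. omega_specs. intros [H _]; exact H.
  - intros a b x. omega_specs. intros [_ H]; exact H.
  - intros a b c H1 H2 x Hx. omega_specs. auto.
  - exact Omega_meet_sup_distr.
  - exact Omega_mul_assoc.
  - exact Omega_mul_e_l.
  - exact Omega_mul_e_r.
  - exact Omega_mul_sup_l.
  - exact Omega_mul_sup_r.
  - exact (image_sup rstar dom star_spec).
  - exact (image_sup rplus cod plus_spec).
  - intros a. apply projection_iff. rewrite star_spec.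
    intros x [y [_ <-]]. apply (cat_dom_dom C HC).
  - intros a. apply projection_iff. rewrite plus_spec.
    intros x [y [_ <-]]. apply (cat_dom_cod C HC).
  - intros a Ha. rewrite projection_iff in Ha. opens_eq. split.
    + intros [y [Hy <-]]. rewrite (Ha y Hy). exact Hy.
    + intro H. exists x. split; [exact H | apply (Ha x H)].
  - intros a Ha. rewrite projection_iff in Ha. opens_eq. split.
    + intros [y [Hy <-]]. rewrite (id_cod HC y (Ha y Hy)). exact Hy.
    + intro H. exists x. split; [exact H | apply (id_cod HC x (Ha x H))].
  - intros a b Ha Hb. rewrite projection_iff in *. intro x. rewrite mul_spec, prod_ids by auto.
    intros [H _]. exact (Ha x H).
  - intros a b Ha Hb. rewrite projection_iff in *. opens_eq. rewrite !prod_ids by auto. tauto.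
  - intros a Ha. rewrite projection_iff in *. opens_eq. rewrite prod_ids by auto. tauto.
  - exact Omega_mul_star.
  - exact Omega_plus_mul.
  - exact Omega_star_mul.
  - exact Omega_plus_mul_r.
  - exact Omega_top_pi_join.
  - exact Omega_pi_mul.
Qed.

End OmegaIsRQF.

Section CoveringFunctors.
Context {C D : topcat} (HC : etale C) (HD : etale D) (F : C -> D) (HF : covering F).

Lemma covering_reflects_ids (x : C) : ids D (F x) -> ids C x.
Proof.
  unfold ids. intro H. apply (f_dinj F HF).
  - rewrite (f_dom F HF). exact H.
  - apply (cat_dom_dom C HC).
Qed.

(* A factorisation of F x lifts uniquely to a factorisation of x: lift the
   left factor along cod x, then the right factor along its domain. *)
Lemma covering_lift_factor (x : C) (u v : D) : dom u = cod v -> F x = comp u v ->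
  exists x1 x2, F x1 = u /\ F x2 = v /\ dom x1 = cod x2 /\ x = comp x1 x2.
Proof.
  intros E Ex.
  destruct (f_rsurj F HF (cod x) u) as [x1 [E1 T1]].
  { unfold ids. apply (cat_dom_cod C HC). }
  { rewrite (f_cod F HF), Ex, (cat_comp_cod D HD) by exact E. reflexivity. }
  destruct (f_rsurj F HF (dom x1) v) as [x2 [E2 T2]].
  { unfold ids. apply (cat_dom_dom C HC). }
  { rewrite (f_dom F HF), T1. exact E. }
  exists x1, x2. split; [exact T1 | split; [exact T2 | split; [symmetry; exact E2|]]].
  symmetry. apply (f_rinj F HF).
  - rewrite (f_comp F HF) by (symmetry; exact E2). rewrite T1, T2. symmetry; exact Ex.
  - rewrite (cat_comp_cod C HC) by (symmetry; exact E2). exact E1.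
Qed.

Lemma covering_preimage_bisection (U : D -> Prop) : bisection D U -> bisection C (preimage F U).
Proof.
  intros [I J]. split.
  - intros y z Hy Hz E. apply (f_dinj F HF); [|exact E]. apply I; auto.
    rewrite <- !(f_dom F HF), E. reflexivity.
  - intros y z Hy Hz E. apply (f_rinj F HF); [|exact E]. apply J; auto.
    rewrite <- !(f_cod F HF), E. reflexivity.
Qed.

Lemma covering_preimage_dom (U : D -> Prop) (x : C) :
  image dom (preimage F U) x <-> preimage F (image dom U) x.
Proof.
  split.
  - intros [y [Hy <-]]. exists (F y). split; [exact Hy|]. symmetry; apply (f_dom F HF).
  - intros [u [Hu Eu]]. assert (Ix : ids C x).
    { apply covering_reflects_ids. unfold ids. rewrite <- Eu. apply (cat_dom_dom D HD). }
    destruct (f_dsurj F HF x u Ix (eq_sym Eu)) as [y [Ey Ty]].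
    exists y. split; [unfold preimage; rewrite Ty; exact Hu | exact Ey].
Qed.

Lemma covering_preimage_cod (U : D -> Prop) (x : C) :
  image cod (preimage F U) x <-> preimage F (image cod U) x.
Proof.
  split.
  - intros [y [Hy <-]]. exists (F y). split; [exact Hy|]. symmetry; apply (f_cod F HF).
  - intros [u [Hu Eu]]. assert (Ix : ids C x).
    { apply covering_reflects_ids. unfold ids. rewrite <- Eu. apply (cat_dom_cod D HD). }
    destruct (f_rsurj F HF x u Ix (eq_sym Eu)) as [y [Ey Ty]].
    exists y. split; [unfold preimage; rewrite Ty; exact Hu | exact Ey].
Qed.

Lemma covering_preimage_prodset (U V : D -> Prop) (x : C) :
  prodset C (preimage F U) (preimage F V) x <-> preimage F (prodset D U V) x.
Proof.
  unfold preimage. split.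
  - intros [u [v [Hu [Hv [E ->]]]]]. exists (F u), (F v).
    split; [exact Hu | split; [exact Hv | split]].
    + rewrite <- (f_dom F HF), <- (f_cod F HF), E. reflexivity.
    + apply (f_comp F HF); exact E.
  - intros [u [v [Hu [Hv [E Ex]]]]].
    destruct (covering_lift_factor x u v E Ex) as [x1 [x2 [T1 [T2 [E12 ->]]]]].
    exists x1, x2. rewrite T1, T2. auto.
Qed.

End CoveringFunctors.

Lemma covering_comp {C D B : topcat} (HC : etale C) (HD : etale D) (F : C -> D) (G : D -> B) :
  covering F -> covering G -> covering (fun x => G (F x)).
Proof.
  intros HF HG. split.
  - intro x. rewrite (f_dom F HF). apply (f_dom G HG).
  - intro x. rewrite (f_cod F HF). apply (f_cod G HG).
  - intros x y H. rewrite (f_comp F HF) by exact H. apply (f_comp G HG).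
    rewrite <- (f_dom F HF), <- (f_cod F HF), H. reflexivity.
  - intros V HV. apply (f_cont F HF (preimage G V)), (f_cont G HG), HV.
  - intros x y E Dxy. apply (f_dinj F HF x y); [|exact Dxy]. apply (f_dinj G HG); [exact E|].
    rewrite <- !(f_dom F HF), Dxy. reflexivity.
  - intros x y E Cxy. apply (f_rinj F HF x y); [|exact Cxy]. apply (f_rinj G HG); [exact E|].
    rewrite <- !(f_cod F HF), Cxy. reflexivity.
  - intros e y Ie Ey.
    assert (IFe : ids D (F e)) by (unfold ids; rewrite <- (f_dom F HF), Ie; reflexivity).
    destruct (f_dsurj G HG (F e) y IFe Ey) as [z [Ez Gz]].
    destruct (f_dsurj F HF e z Ie (eq_sym Ez)) as [x [Ex Fx]].
    exists x. split; [exact Ex|]. rewrite Fx. exact Gz.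
  - intros e y Ie Ey.
    assert (IFe : ids D (F e)) by (unfold ids; rewrite <- (f_dom F HF), Ie; reflexivity).
    destruct (f_rsurj G HG (F e) y IFe Ey) as [z [Ez Gz]].
    destruct (f_rsurj F HF e z Ie (eq_sym Ez)) as [x [Ex Fx]].
    exists x. split; [exact Ex|]. rewrite Fx. exact Gz.
Qed.

Lemma rqf_morphism_comp {Q1 Q2 Q3 : rqf_ops} (f : Q1 -> Q2) (g : Q2 -> Q3) :
  rqf_morphism f -> rqf_morphism g -> rqf_morphism (fun a => g (f a)).
Proof.
  intros Hf Hg. split.
  - intros a b. rewrite (m_mul f Hf). apply (m_mul g Hg).
  - intro S. rewrite (m_sup f Hf), (m_sup g Hg). f_equal. apply pred_ext. intro c. split.
    + intros [b [[a [Ha <-]] <-]]. exists a. auto.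
    + intros [a [Ha <-]]. exists (f a). split; [exists a; auto | reflexivity].
  - intros a b. rewrite (m_meet f Hf). apply (m_meet g Hg).
  - intro a. rewrite (m_star f Hf). apply (m_star g Hg).
  - intro a. rewrite (m_plus f Hf). apply (m_plus g Hg).
  - rewrite (m_top f Hf). apply (m_top g Hg).
  - rewrite (m_e f Hf). apply (m_e g Hg).
  - intros a Ha. apply (m_pi g Hg), (m_pi f Hf), Ha.
Qed.

Definition Omega_map {C C' : topcat} (th : C' -> C) (Hth : covering th) (U : Omega C) : Omega C' :=
  exist _ (preimage th (proj1_sig U)) (f_cont th Hth _ (proj2_sig U)).

Section OmegaMap.
Context {C C' : topcat} (HC : etale C) (HC' : etale C') (th : C' -> C) (Hth : covering th).

Lemma Omega_map_spec (U : Omega C) : proj1_sig (Omega_map th Hth U) = preimage th (proj1_sig U).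
Proof. reflexivity. Qed.

(* The preimage map preserves every operation because covering functors lift
   factorisations, domains and ranges, and reflect identities and bisections. *)
Lemma Omega_map_morphism : rqf_morphism (Omega_map th Hth).
Proof.
  split.
  - intros a b. apply opens_ext. intro x.
    rewrite (mul_spec HC'), !Omega_map_spec, (mul_spec HC).
    symmetry. apply (covering_preimage_prodset HC' HC th Hth).
  - intro S. apply opens_ext. intro x. rewrite Omega_map_spec, !sup_spec. unfold preimage. split.
    + intros [U [HU Hx]]. exists (Omega_map th Hth U). split; [exists U; auto | exact Hx].
    + intros [W [[U [HU <-]] Hx]]. exists U. auto.
  - intros a b. apply opens_ext. intro x.
    rewrite (meet_spec (Omega_map th Hth a)), !Omega_map_spec. unfold preimage.
    rewrite meet_spec. reflexivity.
  - intro a. apply opens_ext. intro x.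
    rewrite (star_spec HC'), !Omega_map_spec, (star_spec HC).
    symmetry. apply (covering_preimage_dom HC' HC th Hth).
  - intro a. apply opens_ext. intro x.
    rewrite (plus_spec HC'), !Omega_map_spec, (plus_spec HC).
    symmetry. apply (covering_preimage_cod HC' HC th Hth).
  - apply opens_ext. intro x. rewrite Omega_map_spec. unfold preimage.
    rewrite (@top_spec C), (@top_spec C'). tauto.
  - apply opens_ext. intro x. rewrite Omega_map_spec. unfold preimage.
    rewrite (e_spec HC), (e_spec HC'). split.
    + apply (covering_reflects_ids HC' th Hth).
    + unfold ids. intro H. rewrite <- (f_dom th Hth), H. reflexivity.
  - intros a Ha. apply (bisection_pi HC'). apply (pi_bisection HC) in Ha.
    exact (covering_preimage_bisection th Hth _ Ha).
Qed.

End OmegaMap.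

Section MorphismPreimage.
Context {Q Q' : rqf_ops} (HQ : rqf_axioms Q) (HQ' : rqf_axioms Q') (ph : Q' -> Q)
  (Hph : rqf_morphism ph).

Lemma morphism_mono a b : rle a b -> rle (ph a) (ph b).
Proof. exact (join_preserving_mono HQ' HQ ph (m_sup ph Hph) a b). Qed.

Lemma preimage_cpfilter A : cpfilter Q A -> cpfilter Q' (preimage ph A).
Proof.
  intro HA. unfold preimage. split; [|split; [|split; [|split]]].
  - exists (rtop Q'). rewrite (m_top ph Hph). exact (filter_top HQ A HA).
  - intros a b Ha H. apply (filter_up A HA (ph a)); [exact Ha | apply morphism_mono; exact H].
  - intros a b Ha Hb. rewrite (m_meet ph Hph). apply (filter_meet A HA); assumption.
  - rewrite (join_preserving_bot ph (m_sup ph Hph)). exact (filter_nbot A HA).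
  - intros S H. rewrite (m_sup ph Hph) in H.
    destruct (filter_prime A HA _ H) as [y [[s [Hs <-]] Hy]]. exists s. auto.
Qed.

(* Taking preimages commutes with the domain: for b* in the domain of A,
   s (b /\ e) lies in the preimage, for any partial isometry s in it. *)
Lemma preimage_up_star A : cpfilter Q A ->
  forall b, up_star Q A (ph b) <-> up_star Q' (preimage ph A) b.
Proof.
  intros HA b. split.
  - intros [a [Ha H]].
    destruct (filter_pi HQ' _ (preimage_cpfilter A HA)) as [s [_ Hs]].
    set (p := rmeet b re).
    assert (Pp : projection Q' p) by apply (meet_lb2 _ HQ').
    exists (rmul s p). split.
    + unfold preimage. rewrite (m_mul ph Hph). apply (filter_mul_dom HQ A HA); [exact Hs|].
      exists a. split; [exact Ha|]. unfold p. rewrite (m_meet ph Hph), (m_e ph Hph).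
      apply (meet_glb _ HQ); [exact H | apply (star_proj _ HQ)].
    + rewrite (star_mul _ HQ'), (star_fix _ HQ').
      * apply (le_trans _ HQ') with p; [|apply (meet_lb1 _ HQ')].
        apply (proj_mul_le_l HQ'), (star_proj _ HQ').
      * apply (proj_mul_closed _ HQ'); [apply (star_proj _ HQ') | exact Pp].
  - intros [c [Hc H]]. exists (ph c). split; [exact Hc|].
    rewrite <- (m_star ph Hph). apply morphism_mono; exact H.
Qed.

(* Taking preimages commutes with products: given c with ph c >= a b, use
   partial isometries s, t in the preimages; then c /\ s t = ((c /\ s t)+ s) t
   and (c /\ s t)+ s lies in the preimage of A. *)
Lemma preimage_up_prod A B : cpfilter Q A -> cpfilter Q B -> composable_sets A B ->
  forall c, up_prod Q A B (ph c) <-> up_prod Q' (preimage ph A) (preimage ph B) c.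
Proof.
  intros HA HB HAB c. split.
  - intro H. pose proof (up_prod_cpfilter HQ A B HA HB HAB) as HP.
    destruct (filter_pi HQ' _ (preimage_cpfilter A HA)) as [s [Ps Hs]].
    destruct (filter_pi HQ' _ (preimage_cpfilter B HB)) as [t [Pt Ht]].
    set (c' := rmeet c (rmul s t)).
    assert (Hc' : up_prod Q A B (ph c')).
    { unfold c'. rewrite (m_meet ph Hph), (m_mul ph Hph). apply (filter_meet _ HP); [exact H|].
      exists (ph s), (ph t). split; [exact Hs | split; [exact Ht | apply (le_refl _ HQ)]]. }
    assert (Ec : c' = rmul (rmul (rplus c') s) t).
    { rewrite (mul_assoc _ HQ'). apply pi_plus_eq;
        [apply (pi_mul _ HQ'); assumption | apply (meet_lb2 _ HQ')]. }
    exists (rmul (rplus c') s), t. split; [|split; [exact Ht|]].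
    + unfold preimage. rewrite (m_mul ph Hph), (m_plus ph Hph).
      apply (filter_mul_cod HQ); [exact HA | exact Hs|].
      apply (up_prod_cod HQ A B HA HB HAB).
      exists (ph c'). split; [exact Hc' | apply (le_refl _ HQ)].
    + rewrite <- Ec. apply (meet_lb1 _ HQ').
  - intros [a [b [Ha [Hb H]]]]. exists (ph a), (ph b). split; [exact Ha | split; [exact Hb|]].
    rewrite <- (m_mul ph Hph). apply morphism_mono; exact H.
Qed.

End MorphismPreimage.

Lemma preimage_up_plus {Q Q' : rqf_ops} (HQ : rqf_axioms Q) (HQ' : rqf_axioms Q') (ph : Q' -> Q)
  (Hph : rqf_morphism ph) A : cpfilter Q A ->
  forall b, up_plus Q A (ph b) <-> up_plus Q' (preimage ph A) b.
Proof. exact (preimage_up_star (op_axioms HQ) (op_axioms HQ') ph (morph_op ph Hph) A). Qed.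


Definition C_map {Q Q' : rqf_ops} (HQ : rqf_axioms Q) (HQ' : rqf_axioms Q') (ph : Q' -> Q)
  (Hph : rqf_morphism ph) (A : Filt Q) : Filt Q' :=
  exist _ (preimage ph (proj1_sig A)) (preimage_cpfilter HQ HQ' ph Hph _ (filt_cpfilter A)).

Section CMap.
Context {Q Q' : rqf_ops} (HQ : rqf_axioms Q) (HQ' : rqf_axioms Q') (ph : Q' -> Q)
  (Hph : rqf_morphism ph).
Local Notation g := (C_map HQ HQ' ph Hph).

Lemma C_map_dom (x : Filt Q) : g (filt_dom Q x) = filt_dom Q' (g x).
Proof.
  apply filt_ext. intro a. rewrite (dom_spec HQ'). simpl. unfold preimage.
  rewrite (dom_spec HQ). apply (preimage_up_star HQ HQ' ph Hph), filt_cpfilter.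
Qed.

Lemma C_map_cod (x : Filt Q) : g (filt_cod Q x) = filt_cod Q' (g x).
Proof.
  apply filt_ext. intro a. rewrite (cod_spec HQ'). simpl. unfold preimage.
  rewrite (cod_spec HQ). apply (preimage_up_plus HQ HQ' ph Hph), filt_cpfilter.
Qed.

Lemma C_map_comp (x y : Filt Q) :
  filt_dom Q x = filt_cod Q y -> g (filt_comp Q x y) = filt_comp Q' (g x) (g y).
Proof.
  intro Hxy.
  assert (H' : filt_dom Q' (g x) = filt_cod Q' (g y))
    by (rewrite <- C_map_dom, <- C_map_cod, Hxy; reflexivity).
  apply (composable_iff HQ) in Hxy. apply (composable_iff HQ') in H'.
  apply filt_ext. intro c. rewrite (comp_spec HQ' _ _ H'). simpl. unfold preimage.
  rewrite (comp_spec HQ _ _ Hxy).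
  apply (preimage_up_prod HQ HQ' ph Hph); try apply filt_cpfilter. exact Hxy.
Qed.

(* Rigidity on the image: g x = g y with equal domains share the partial
   isometry ph s for s a partial isometry in g x. *)
Lemma C_map_dinj (x y : Filt Q) : g x = g y -> filt_dom Q x = filt_dom Q y -> x = y.
Proof.
  intros E1 E2. apply filt_ext.
  destruct (filter_pi HQ' _ (filt_cpfilter (g x))) as [s [Ps Hs]].
  assert (Hs' : proj1_sig (g y) s) by (rewrite <- E1; exact Hs).
  apply (filter_eq_by_pi HQ) with (ph s); try apply filt_cpfilter;
    [apply (m_pi ph Hph); exact Ps | exact Hs | exact Hs'|].
  intro b. rewrite <- !(dom_spec HQ), E2. reflexivity.
Qed.

Lemma C_map_rinj (x y : Filt Q) : g x = g y -> filt_cod Q x = filt_cod Q y -> x = y.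
Proof.
  intros E1 E2. apply filt_ext.
  destruct (filter_pi HQ' _ (filt_cpfilter (g x))) as [s [Ps Hs]].
  assert (Hs' : proj1_sig (g y) s) by (rewrite <- E1; exact Hs).
  apply (filter_eq_by_pi_cod HQ) with (ph s); try apply filt_cpfilter;
    [apply (m_pi ph Hph); exact Ps | exact Hs | exact Hs'|].
  intro b. rewrite <- !(cod_spec HQ), E2. reflexivity.
Qed.

(* Surjectivity: lift the identity filter e along ph s, s a partial isometry
   in y; its image agrees with y by rigidity. *)
Lemma C_map_dsurj (e : Filt Q) (y : Filt Q') : ids (CQ Q) e -> g e = filt_dom Q' y ->
  exists x, filt_dom Q x = e /\ g x = y.
Proof.
  intros Ie Ey. apply (ids_iff HQ) in Ie.
  destruct (filter_pi HQ' _ (filt_cpfilter y)) as [s [Ps Hs]].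
  assert (Hse : proj1_sig e (rstar (ph s))).
  { rewrite <- (m_star ph Hph). change (proj1_sig (g e) (rstar s)). rewrite Ey, (dom_spec HQ').
    exists s. split; [exact Hs | apply (le_refl _ HQ')]. }
  destruct (lift_spec HQ (ph s) (proj1_sig e) (m_pi ph Hph s Ps) (filt_cpfilter e) Ie Hse)
    as [K1 [K2 K3]].
  exists (exist _ (lift Q (ph s) (proj1_sig e)) K1). split.
  - apply filt_ext. intro c. rewrite (dom_spec HQ). apply K2.
  - apply filt_ext. apply (filter_eq_by_pi HQ') with s; try apply filt_cpfilter;
      [exact Ps | exact K3 | exact Hs|].
    intro b. simpl. rewrite <- (preimage_up_star HQ HQ' ph Hph _ K1 b), K2.
    rewrite <- (dom_spec HQ' y), <- Ey. reflexivity.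
Qed.

Lemma C_map_rsurj (e : Filt Q) (y : Filt Q') : ids (CQ Q) e -> g e = filt_cod Q' y ->
  exists x, filt_cod Q x = e /\ g x = y.
Proof.
  intros Ie Ey. apply (ids_iff HQ) in Ie.
  destruct (filter_pi HQ' _ (filt_cpfilter y)) as [s [Ps Hs]].
  assert (Hse : proj1_sig e (rplus (ph s))).
  { rewrite <- (m_plus ph Hph). change (proj1_sig (g e) (rplus s)). rewrite Ey, (cod_spec HQ').
    exists s. split; [exact Hs | apply (le_refl _ HQ')]. }
  destruct (lift_plus_spec HQ (ph s) (proj1_sig e) (m_pi ph Hph s Ps) (filt_cpfilter e) Ie Hse)
    as [K1 [K2 K3]].
  exists (exist _ (lift_plus Q (ph s) (proj1_sig e)) K1). split.
  - apply filt_ext. intro c. rewrite (cod_spec HQ). apply K2.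
  - apply filt_ext. apply (filter_eq_by_pi_cod HQ') with s; try apply filt_cpfilter;
      [exact Ps | exact K3 | exact Hs|].
    intro b. simpl. rewrite <- (preimage_up_plus HQ HQ' ph Hph _ K1 b), K2.
    rewrite <- (cod_spec HQ' y), <- Ey. reflexivity.
Qed.

Theorem C_map_covering : @covering (CQ Q) (CQ Q') g.
Proof.
  split.
  - exact C_map_dom.
  - exact C_map_cod.
  - exact C_map_comp.
  - apply (continuous_into_CQ (CQ Q)). intros a _. exact (chi_open HQ (ph a)).
  - exact C_map_dinj.
  - exact C_map_rinj.
  - exact C_map_dsurj.
  - exact C_map_rsurj.
Qed.

End CMap.

Section Unit.
Context {Q : rqf_ops} (HQ : rqf_axioms Q).
Local Notation PI := (partial_isometry Q).

(* With partial isometries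
   a' <= a, b' <= b and a' b' in X, take B the lift of b' along the domain F of
   X, and A the lift of a' along the range of B; rigidity gives A . B = X. *)
Lemma filter_factorisation (X : Filt Q) a b : proj1_sig X (rmul a b) ->
  exists A B : Filt Q, proj1_sig A a /\ proj1_sig B b /\
    filt_dom Q A = filt_cod Q B /\ filt_comp Q A B = X.
Proof.
  intro H. pose proof (filt_cpfilter X) as HX.
  rewrite (sup_pi_below HQ a), (mul_sup_r _ HQ) in H.
  destruct (filter_prime _ HX _ H) as [y [[a' [[Pa' Ha'] <-]] H1]].
  rewrite (sup_pi_below HQ b), (mul_sup_l _ HQ) in H1.
  destruct (filter_prime _ HX _ H1) as [y [[b' [[Pb' Hb'] <-]] H2]].
  set (F := up_star Q (proj1_sig X)).
  assert (HF : cpfilter Q F) by (apply (up_star_cpfilter HQ); exact HX).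
  assert (Fab : F (rstar (rmul a' b')))
    by (exists (rmul a' b'); split; [exact H2 | apply (le_refl _ HQ)]).
  assert (Fb : F (rstar b')).
  { apply (filter_up F HF _ _ Fab). rewrite (star_mul _ HQ). apply (star_mono HQ).
    apply (proj_mul_le_l HQ), (star_proj _ HQ). }
  destruct (lift_spec HQ b' F Pb' HF (up_star_e HQ _ HX) Fb) as [K1 [K2 K3]].
  set (G := up_plus Q (lift Q b' F)).
  assert (HG : cpfilter Q G) by (apply (up_plus_cpfilter HQ); exact K1).
  assert (Ga : G (rstar a')).
  { exists (rmul b' (rstar (rmul a' b'))). split; [|apply (pi_restrict_range HQ); exact Pb'].
    exists (rstar (rmul a' b')). split; [exact Fab | apply (le_refl _ HQ)]. }
  destruct (lift_spec HQ a' G Pa' HG (up_plus_e HQ _ K1) Ga) as [J1 [J2 J3]].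
  set (A := exist _ (lift Q a' G) J1 : Filt Q).
  set (B := exist _ (lift Q b' F) K1 : Filt Q).
  assert (Hc : composable_sets (proj1_sig A) (proj1_sig B)) by exact J2.
  exists A, B. split; [|split; [|split]].
  - apply (filter_up _ J1 a'); [exact J3 | exact Ha'].
  - apply (filter_up _ K1 b'); [exact K3 | exact Hb'].
  - apply (composable_iff HQ). exact Hc.
  - apply filt_ext. rewrite (comp_spec HQ _ _ Hc).
    apply (filter_eq_by_pi HQ) with (rmul a' b');
      [apply (up_prod_cpfilter HQ); [exact J1 | exact K1 | exact Hc] | exact HX |
       apply (pi_mul _ HQ); assumption | | exact H2 |].
    + exists a', b'. split; [exact J3 | split; [exact K3 | apply (le_refl _ HQ)]].
    + intro x. cbn [proj1_sig A B]. rewrite (up_prod_dom HQ _ _ J1 K1 Hc). apply K2.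
Qed.

Definition chi_opens (a : Q) : Omega (CQ Q) := exist _ (chi Q a) (chi_open HQ a).

Lemma chi_opens_spec (a : Q) : proj1_sig (chi_opens a) = chi Q a.
Proof. reflexivity. Qed.

(* X_(a* ) = dom(X_a): a filter x containing a* contains b* for a partial
   isometry b <= a, and the lift of b along x has domain x and contains a. *)
Lemma chi_star (a : Q) (x : Filt Q) : chi Q (rstar a) x <-> image (filt_dom Q) (chi Q a) x.
Proof.
  unfold chi. split.
  - intro H. destruct (filter_star_pi HQ _ (filt_cpfilter x) a H) as [b [Pb [Hba Hb]]].
    assert (Ie : proj1_sig x re).
    { apply (filter_up _ (filt_cpfilter x)) with (rstar b); [exact Hb | apply (star_proj _ HQ)]. }
    destruct (lift_spec HQ b _ Pb (filt_cpfilter x) Ie Hb) as [K1 [K2 K3]].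
    exists (exist _ (lift Q b (proj1_sig x)) K1). split.
    + apply (filter_up _ K1 b); [exact K3 | exact Hba].
    + apply filt_ext. intro c. rewrite (dom_spec HQ). apply K2.
  - intros [y [Hy <-]]. rewrite (dom_spec HQ). exists a. split; [exact Hy | apply (le_refl _ HQ)].
Qed.

Lemma chi_plus (a : Q) (x : Filt Q) : chi Q (rplus a) x <-> image (filt_cod Q) (chi Q a) x.
Proof.
  unfold chi. split.
  - intro H. destruct (filter_plus_pi HQ _ a (filt_cpfilter x) H) as [b [Pb [Hba Hb]]].
    assert (Ie : proj1_sig x re).
    { apply (filter_up _ (filt_cpfilter x)) with (rplus b); [exact Hb | apply (plus_proj _ HQ)]. }
    destruct (lift_plus_spec HQ b _ Pb (filt_cpfilter x) Ie Hb) as [K1 [K2 K3]].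
    exists (exist _ (lift_plus Q b (proj1_sig x)) K1). split.
    + apply (filter_up _ K1 b); [exact K3 | exact Hba].
    + apply filt_ext. intro c. rewrite (cod_spec HQ). apply K2.
  - intros [y [Hy <-]]. rewrite (cod_spec HQ). exists a. split; [exact Hy | apply (le_refl _ HQ)].
Qed.

Lemma chi_bisection (a : Q) : PI a -> bisection (CQ Q) (chi Q a).
Proof.
  intro Pa. split.
  - intros y z Hy Hz E. apply filt_ext.
    apply (filter_eq_by_pi HQ) with a; try apply filt_cpfilter; auto.
    intro b. rewrite <- !(dom_spec HQ). simpl in E. rewrite E. reflexivity.
  - intros y z Hy Hz E. apply filt_ext.
    apply (filter_eq_by_pi_cod HQ) with a; try apply filt_cpfilter; auto.
    intro b. rewrite <- !(cod_spec HQ). simpl in E. rewrite E. reflexivity.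
Qed.

Theorem chi_morphism : rqf_morphism chi_opens.
Proof.
  pose proof (CQ_etale HQ) as HCQ.
  split.
  - intros a b. apply opens_ext. intro x. rewrite (mul_spec HCQ), !chi_opens_spec. split.
    + intro H. destruct (filter_factorisation x a b H) as [A [B [Ha [Hb [E <-]]]]].
      exists A, B. auto.
    + intros [A [B [Ha [Hb [E ->]]]]]. apply (composable_iff HQ) in E. unfold chi.
      simpl. rewrite (comp_spec HQ _ _ E).
      exists a, b. split; [exact Ha | split; [exact Hb | apply (le_refl _ HQ)]].
  - intro S. apply opens_ext. intro x. rewrite sup_spec, chi_opens_spec. unfold chi. split.
    + intro H. destruct (filter_prime _ (filt_cpfilter x) _ H) as [s [Hs Hx]].
      exists (chi_opens s). split; [exists s; auto | exact Hx].
    + intros [U [[s [Hs <-]] Hx]].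
      apply (filter_up _ (filt_cpfilter x)) with s; [exact Hx | apply (sup_ub _ HQ); exact Hs].
  - intros a b. apply opens_ext. intro x. rewrite meet_spec, !chi_opens_spec. unfold chi. split.
    + intro H. split; apply (filter_up _ (filt_cpfilter x)) with (rmeet a b);
        [exact H | apply (meet_lb1 _ HQ) | exact H | apply (meet_lb2 _ HQ)].
    + intros [H1 H2]. apply (filter_meet _ (filt_cpfilter x)); assumption.
  - intro a. apply opens_ext. intro x. rewrite (star_spec HCQ), !chi_opens_spec. apply chi_star.
  - intro a. apply opens_ext. intro x. rewrite (plus_spec HCQ), !chi_opens_spec. apply chi_plus.
  - apply opens_ext. intro x. rewrite top_spec, chi_opens_spec. split; [auto|].
    intros _. exact (filter_top HQ _ (filt_cpfilter x)).
  - apply opens_ext. intro x. rewrite (e_spec HCQ), chi_opens_spec. symmetry. apply (ids_iff HQ).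
  - intros a Pa. apply (bisection_pi HCQ). exact (chi_bisection a Pa).
Qed.

End Unit.

Section Counit.
Context {C : topcat} (HC : etale C).
Local Notation HO := (Omega_axioms HC).

Lemma omega_cpfilter (x : C) : cpfilter (Omega C) (omega C x).
Proof.
  unfold omega. split; [|split; [|split; [|split]]].
  - exists (rtop (Omega C)). rewrite top_spec. exact I.
  - intros U V HU HUV. exact (HUV x HU).
  - intros U V HU HV. rewrite meet_spec. auto.
  - rewrite bot_spec. auto.
  - intros S H. rewrite sup_spec in H. exact H.
Qed.

Definition omega_filter (x : C) : Filt (Omega C) := exist _ (omega C x) (omega_cpfilter x).

(* U contains dom x iff U >= V* for an open V containing x; take V the
   preimage of U under dom. *)
Lemma omega_dom (x : C) : omega_filter (dom x) = filt_dom (Omega C) (omega_filter x).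
Proof.
  apply filt_ext. intro U. rewrite (dom_spec HO). unfold up_star, omega. simpl proj1_sig. split.
  - intro H. exists (exist _ (preimage dom (proj1_sig U)) (dom_cont C HC _ (proj2_sig U))).
    split; [exact H|]. intros y. rewrite (star_spec HC). intros [z [Hz <-]]. exact Hz.
  - intros [V [HV HVU]]. apply HVU. rewrite (star_spec HC). exists x. auto.
Qed.

Lemma omega_cod (x : C) : omega_filter (cod x) = filt_cod (Omega C) (omega_filter x).
Proof.
  apply filt_ext. intro U. rewrite (cod_spec HO). unfold up_plus, omega. simpl proj1_sig. split.
  - intro H. exists (exist _ (preimage cod (proj1_sig U)) (cod_cont C HC _ (proj2_sig U))).
    split; [exact H|]. intros y. rewrite (plus_spec HC). intros [z [Hz <-]]. exact Hz.
  - intros [V [HV HVU]]. apply HVU. rewrite (plus_spec HC). exists x. auto.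
Qed.

(* W contains x y iff W >= U V for opens U, V containing x, y: continuity of
   composition. *)
Lemma omega_comp (x y : C) : dom x = cod y ->
  omega_filter (comp x y) = filt_comp (Omega C) (omega_filter x) (omega_filter y).
Proof.
  intro Hxy.
  assert (Hc : composable_sets (proj1_sig (omega_filter x)) (proj1_sig (omega_filter y))).
  { apply (composable_iff HO (omega_filter x) (omega_filter y)).
    rewrite <- omega_dom, <- omega_cod, Hxy. reflexivity. }
  apply filt_ext. intro W. rewrite (comp_spec HO _ _ Hc).
  unfold up_prod, omega. simpl proj1_sig. split.
  - intro H. destruct (comp_cont C HC _ x y (proj2_sig W) Hxy H) as [U [V [HU [HV [Ux [Vy K]]]]]].
    exists (exist _ U HU), (exist _ V HV). split; [exact Ux | split; [exact Vy|]].
    intro z. rewrite (mul_spec HC). intros [u [v [Hu [Hv [E ->]]]]]. apply K; assumption.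
  - intros [U [V [Ux [Vy HUV]]]]. apply HUV. rewrite (mul_spec HC). exists x, y. auto.
Qed.

Lemma omega_rigid (x : C) (Y : Filt (Omega C)) (U : Omega C) :
  partial_isometry (Omega C) U -> proj1_sig U x -> proj1_sig Y U ->
  filt_dom (Omega C) (omega_filter x) = filt_dom (Omega C) Y -> omega_filter x = Y.
Proof.
  intros PU Ux YU E. apply filt_ext.
  apply (filter_eq_by_pi HO) with U; try apply filt_cpfilter; auto.
  intro V. rewrite <- !(dom_spec HO), E. reflexivity.
Qed.

Lemma omega_rigid_cod (x : C) (Y : Filt (Omega C)) (U : Omega C) :
  partial_isometry (Omega C) U -> proj1_sig U x -> proj1_sig Y U ->
  filt_cod (Omega C) (omega_filter x) = filt_cod (Omega C) Y -> omega_filter x = Y.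
Proof.
  intros PU Ux YU E. apply filt_ext.
  apply (filter_eq_by_pi_cod HO) with U; try apply filt_cpfilter; auto.
  intro V. rewrite <- !(cod_spec HO), E. reflexivity.
Qed.

Theorem omega_covering : @covering C (CQ (Omega C)) omega_filter.
Proof.
  split.
  - exact omega_dom.
  - exact omega_cod.
  - exact omega_comp.
  - apply (continuous_into_CQ C). intros a _. exact (proj2_sig a).
  - (* a dom-injective open neighbourhood of x is also one of y *)
    intros x y E Dxy. destruct (dom_lh C HC x) as [U [HU [Ux [Inj _]]]].
    apply Inj; [exact Ux | | exact Dxy].
    change (omega C y (exist _ U HU)).
    rewrite <- (f_equal (@proj1_sig _ _) E : omega C x = omega C y). exact Ux.
  - intros x y E Cxy. destruct (cod_lh C HC x) as [U [HU [Ux [Inj _]]]].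
    apply Inj; [exact Ux | | exact Cxy].
    change (omega C y (exist _ U HU)).
    rewrite <- (f_equal (@proj1_sig _ _) E : omega C x = omega C y). exact Ux.
  - (* for a bisection U in Y, e lies in dom(U), so e = dom x with x in U;
       then omega(x) = Y by rigidity *)
    intros e Y _ Ey. change (omega_filter e = filt_dom (Omega C) Y) in Ey.
    destruct (filter_pi HO _ (filt_cpfilter Y)) as [U [PU YU]].
    assert (He : proj1_sig (@rstar (Omega C) U) e).
    { change (proj1_sig (omega_filter e) (rstar U)). rewrite Ey, (dom_spec HO).
      exists U. split; [exact YU | apply (le_refl _ HO)]. }
    rewrite (star_spec HC) in He. destruct He as [x [Ux Ex]].
    exists x. split; [exact Ex|]. apply (omega_rigid x Y U PU Ux YU).
    rewrite <- omega_dom, Ex, Ey. reflexivity.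
  - intros e Y _ Ey. change (omega_filter e = filt_cod (Omega C) Y) in Ey.
    destruct (filter_pi HO _ (filt_cpfilter Y)) as [U [PU YU]].
    assert (He : proj1_sig (@rplus (Omega C) U) e).
    { change (proj1_sig (omega_filter e) (rplus U)). rewrite Ey, (cod_spec HO).
      exists U. split; [exact YU | apply (le_refl _ HO)]. }
    rewrite (plus_spec HC) in He. destruct He as [x [Ux Ex]].
    exists x. split; [exact Ex|]. apply (omega_rigid_cod x Y U PU Ux YU).
    rewrite <- omega_cod, Ex, Ey. reflexivity.
Qed.

End Counit.

Section Adjunction.
Context {C : topcat} {Q : rqf_ops} (HC : etale C) (HQ : rqf_axioms Q).

Lemma transpose_of_covering (al : C -> CQ Q) (Hal : covering al) :
  exists! be : Q -> Omega C, rqf_morphism be /\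
    forall a, set_eq (proj1_sig (be a)) (preimage al (chi Q a)).
Proof.
  exists (fun a => Omega_map al Hal (chi_opens HQ a)). split.
  - split; [|intros a x; reflexivity].
    apply rqf_morphism_comp; [apply chi_morphism | apply (Omega_map_morphism (CQ_etale HQ) HC)].
  - intros be [_ E]. apply functional_extensionality. intro a. apply opens_ext. intro x.
    symmetry. apply E.
Qed.

Lemma transpose_of_morphism (be : Q -> Omega C) (Hbe : rqf_morphism be) :
  exists! al : C -> CQ Q, covering al /\
    forall x, set_eq (proj1_sig (al x)) (preimage be (omega C x)).
Proof.
  exists (fun x => C_map (Omega_axioms HC) HQ be Hbe (omega_filter x)). split.
  - split; [|intros x a; reflexivity].
    apply (covering_comp HC (CQ_etale (Omega_axioms HC)));
      [exact (omega_covering HC) | apply C_map_covering].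
  - intros al [_ E]. apply functional_extensionality. intro x. apply filt_ext. intro a.
    symmetry. apply E.
Qed.

Lemma transposes_agree (al : C -> CQ Q) (be : Q -> Omega C) :
  (forall a, set_eq (proj1_sig (be a)) (preimage al (chi Q a))) <->
  (forall x, set_eq (proj1_sig (al x)) (preimage be (omega C x))).
Proof. split; intros H x a; symmetry; apply H. Qed.

End Adjunction.

(* Naturality: x' in beta'(a') iff th x' in beta(ph a') iff ph a' in
   alpha(th x') iff a' in alpha'(x'). *)
Lemma transpose_natural {C C' : topcat} {Q Q' : rqf_ops} (th : C' -> C) (ph : Q' -> Q)
    (al : C -> CQ Q) (be : Q -> Omega C) (al' : C' -> CQ Q') (be' : Q' -> Omega C') :
  (forall a, set_eq (proj1_sig (be a)) (preimage al (chi Q a))) ->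
  (forall x', set_eq (proj1_sig (al' x')) (preimage ph (proj1_sig (al (th x'))))) ->
  (forall a', set_eq (proj1_sig (be' a')) (preimage th (proj1_sig (be (ph a'))))) ->
  forall a', set_eq (proj1_sig (be' a')) (preimage al' (chi Q' a')).
Proof.
  intros H1 H2 H3 a' x'.
  unfold preimage, chi. rewrite (H3 a' x'). unfold preimage. rewrite (H1 (ph a') (th x')).
  unfold preimage, chi. rewrite (H2 x' a'). reflexivity.
Qed.

Theorem mainTheorem18 :
  (* Omega is well defined on objects and morphisms *)
  (forall C : topcat, etale C -> rqf_axioms (Omega C)) /\
  (forall (C C' : topcat) (th : C' -> C), etale C -> etale C' -> covering th ->
     exists f : Omega C -> Omega C', rqf_morphism f /\
       forall U, set_eq (proj1_sig (f U)) (preimage th (proj1_sig U))) /\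
  (* C(-) is well defined on objects and morphisms *)
  (forall Q : rqf_ops, rqf_axioms Q -> etale (CQ Q)) /\
  (forall (Q Q' : rqf_ops) (ph : Q' -> Q), rqf_axioms Q -> rqf_axioms Q' ->
     rqf_morphism ph ->
     exists g : CQ Q -> CQ Q', covering g /\
       forall A, set_eq (proj1_sig (g A)) (preimage ph (proj1_sig A))) /\
  (* the adjunction bijection *)
  (forall (C : topcat) (Q : rqf_ops), etale C -> rqf_axioms Q ->
     (forall al : C -> CQ Q, covering al ->
        exists! be : Q -> Omega C, rqf_morphism be /\
          forall a, set_eq (proj1_sig (be a)) (preimage al (chi Q a))) /\
     (forall be : Q -> Omega C, rqf_morphism be ->
        exists! al : C -> CQ Q, covering al /\
          forall x, set_eq (proj1_sig (al x)) (preimage be (omega C x))) /\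
     (forall (al : C -> CQ Q) (be : Q -> Omega C), covering al -> rqf_morphism be ->
        ((forall a, set_eq (proj1_sig (be a)) (preimage al (chi Q a))) <->
         (forall x, set_eq (proj1_sig (al x)) (preimage be (omega C x)))))) /\
  (* naturality in C and Q *)
  (forall (C C' : topcat) (Q Q' : rqf_ops) (th : C' -> C) (ph : Q' -> Q)
          (al : C -> CQ Q) (be : Q -> Omega C)
          (al' : C' -> CQ Q') (be' : Q' -> Omega C'),
     etale C -> etale C' -> rqf_axioms Q -> rqf_axioms Q' ->
     covering th -> rqf_morphism ph -> covering al -> rqf_morphism be ->
     (forall a, set_eq (proj1_sig (be a)) (preimage al (chi Q a))) ->
     (forall x', set_eq (proj1_sig (al' x')) (preimage ph (proj1_sig (al (th x'))))) ->
     (forall a', set_eq (proj1_sig (be' a')) (preimage th (proj1_sig (be (ph a'))))) ->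
     forall a', set_eq (proj1_sig (be' a')) (preimage al' (chi Q' a'))).
Proof.
  split; [exact @Omega_axioms|].
  split.
  { intros C C' th HC HC' Hth. exists (Omega_map th Hth).
    split; [exact (Omega_map_morphism HC HC' th Hth) | intros U x; reflexivity]. }
  split; [exact @CQ_etale|].
  split.
  { intros Q Q' ph HQ HQ' Hph. exists (C_map HQ HQ' ph Hph).
    split; [exact (C_map_covering HQ HQ' ph Hph) | intros A a; reflexivity]. }
  split.
  - intros C Q HC HQ. split; [exact (transpose_of_covering HC HQ) |].
    split; [exact (transpose_of_morphism HC HQ) |].
    intros al be _ _. apply transposes_agree.
  - intros C C' Q Q' th ph al be al' be' _ _ _ _ _ _ _ _. apply transpose_natural.
Qed.
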